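(* Let $R,J:\mathbb{R}^n\to]-\infty,+\infty]$ be proper, convex and lower semi-continuous with $\mathrm{ri}(\mathrm{dom}(R))\cap\mathrm{ri}(\mathrm{dom}(J))\neq\emptyset$ and $\mathrm{Argmin}(R+J)\neq\emptyset$. Let $\gamma>0$, $z_0\in\mathbb{R}^n$, $x_0=\mathrm{prox}_{\gamma J}(z_0)$, and let the sequences $\{u_k\},\{z_k\},\{x_k\}$ be generated by the Douglas--Rachford iteration $$u_{k+1}=\mathrm{prox}_{\gamma R}(2x_k-z_k),\qquad z_{k+1}=z_k+u_{k+1}-x_k,\qquad x_{k+1}=\mathrm{prox}_{\gamma J}(z_{k+1}).$$ Then $\{z_k\}$ converges to a point $z^\star\in\mathrm{fix}(\mathcal{F}_{\mathrm{DR}})$, and $\{x_k\},\{u_k\}$ converge to $x^\star=\mathrm{prox}_{\gamma J}(z^\star)\in\mathrm{Argmin}(R+J)$. If, moreover, $R$ is partly smooth at $x^\star$ relative to a $C^2$-manifold $\mathcal{M}^R_{x^\star}$, $J$ is partly smooth at $x^\star$ relative to a $C^2$-manifold $\mathcal{M}^J_{x^\star}$, and the non-degeneracy condition $$x^\star-z^\star\in\gamma\,\mathrm{ri}(\partial R(x^\star))\quad\text{and}\quad z^\star-x^\star\in\gamma\,\mathrm{ri}(\partial J(x^\star))$$ holds, then there exists a matrix $M_{\mathrm{DR}}$ such that for all $k$ large enough $$z_{k+1}-z_k=M_{\mathrm{DR}}(z_k-z_{k-1})+o(\|z_k-z_{k-1}\|).$$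
   Context: $\mathrm{prox}_{\gamma R}(w)=\mathrm{argmin}_{x\in\mathbb{R}^n}\ \gamma R(x)+\frac12\|x-w\|^2$; $\partial R$ is the convex subdifferential; $\mathrm{ri}$ is the relative interior; $\mathrm{par}(C)$ is the linear subspace parallel to the affine hull of a convex set $C$. The fixed-point operator is $\mathcal{F}_{\mathrm{DR}}=\frac12\big((2\mathrm{prox}_{\gamma R}-\mathrm{Id})(2\mathrm{prox}_{\gamma J}-\mathrm{Id})+\mathrm{Id}\big)$, so $z_{k+1}=\mathcal{F}_{\mathrm{DR}}(z_k)$, and $\mathrm{fix}$ denotes the set of fixed points. A proper convex lower semi-continuous function $R$ on $\mathbb{R}^n$ is partly smooth at $\bar x$ relative to a set $\mathcal{M}_{\bar x}$ if $\mathcal{M}_{\bar x}$ is a $C^2$ manifold (embedded submanifold of $\mathbb{R}^n$) around $\bar x$ and: (Smoothness) $R$ restricted to $\mathcal{M}_{\bar x}$ is $C^2$ around $\bar x$; (Sharpness) the tangent space of $\mathcal{M}_{\bar x}$ at $\bar x$ equals $\mathrm{par}(\partial R(\bar x))^\perp$; (Continuity) the set-valued map $\partial R$ is continuous at $\bar x$ relative to $\mathcal{M}_{\bar x}$. *)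

(* Defs.v *)
(* R^n is 'cV[K]_n with K : realType.  Its library topology (sup norm) is the
   usual one; every norm occurring in a formula is the Euclidean [enorm]. *)
From HB Require Import structures.
From mathcomp Require Import all_boot all_order all_algebra.
From mathcomp Require Import all_classical all_reals all_analysis.

Set Implicit Arguments.
Unset Strict Implicit.
Unset Printing Implicit Defensive.
Import Order.TTheory GRing.Theory Num.Theory.
Import numFieldNormedType.Exports.

Local Open Scope classical_set_scope.
Local Open Scope ring_scope.

Section Euclidean.
Context {K : realType} {n : nat}.
Local Notation E := 'cV[K]_n.

Definition dot (u v : E) : K := \sum_(i < n) u i 0 * v i 0.

Definition enorm (v : E) : K := Num.sqrt (dot v v).

Definition orth (A : set E) : set E :=
  [set v | forall w, A w -> dot v w = 0].

Definition affine_set (A : set E) : Prop :=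
  forall x y t, A x -> A y -> A ((1 - t) *: x + t *: y).

Definition affine_hull (A : set E) : set E := smallest affine_set A.

(* The linear subspace parallel to the affine hull of A (A nonempty). *)
Definition par (A : set E) : set E :=
  [set v | exists x y, [/\ affine_hull A x, affine_hull A y & v = x - y]].

Definition ri (A : set E) : set E :=
  [set x | A x /\ \forall y \near x, affine_hull A y -> A y].

End Euclidean.

Section ConvexAnalysis.
Context {K : realType} {n : nat}.
Local Notation E := 'cV[K]_n.
Implicit Types (F : E -> \bar K) (x y w : E) (gamma : K).

Definition edom F : set E := [set x | (F x < +oo)%E].

Definition proper_fun F : Prop := (forall x, F x != -oo%E) /\ edom F !=set0.

Definition convex_fun F : Prop :=
  forall x y (t : K), 0 <= t <= 1 ->
    (F (t *: x + (1 - t) *: y)%R <= t%:E * F x + (1 - t)%:E * F y)%E.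

Definition argmin F : set E := [set x | forall y, (F x <= F y)%E].

Definition subdiff F x : set E :=
  [set g | forall y, (F x + (dot g (y - x))%:E <= F y)%E].

(* For F proper, convex, lsc and gamma > 0 the minimiser exists and is unique;
   0 is only a default value outside of that case. *)
Definition prox gamma F w : E :=
  xget 0 (argmin (fun x => gamma%:E * F x + (2^-1 * enorm (x - w) ^+ 2)%:E)%E).

Definition reflector gamma F w : E := 2 *: prox gamma F w - w.

Definition F_DR gamma (R J : E -> \bar K) w : E :=
  2^-1 *: (reflector gamma R (reflector gamma J w) + w).

Definition fixpoints (T : E -> E) : set E := [set z | T z = z].

End ConvexAnalysis.

(* Class C^k on an open set U of a finite-dimensional space: the differentials
   are taken in fixed directions v, and in finite dimension continuity of
   x |-> 'd f x v for every v amounts to continuity of x |-> 'd f x. *)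
Fixpoint Ck {K : realType} {V W : normedModType K} (k : nat)
    (U : set V) (f : V -> W) : Prop :=
  match k with
  | 0 => forall x, U x -> {for x, continuous f}
  | k'.+1 => (forall x, U x -> differentiable f x) /\
             (forall v : V, Ck k' U (fun x => 'd f x v))
  end.

Section Manifolds.
Context {K : realType} {n : nat}.
Local Notation E := 'cV[K]_n.
Implicit Types (M U W : set E) (x v : E).

Definition C2_diffeo U W (psi phi : E -> E) : Prop :=
  [/\ open U, open W, Ck 2 U psi, Ck 2 W phi &
      (forall y, U y -> W (psi y) /\ phi (psi y) = y) /\
      (forall w, W w -> U (phi w) /\ psi (phi w) = w)].

(* Embedded submanifold around x, by a slice chart: a C^2 diffeomorphism psi
   from a neighbourhood U of x which maps M `&` U onto the points of psi(U)
   whose coordinates of index >= d vanish. *)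
Definition C2_manifold_around M x : Prop :=
  M x /\
  exists (d : nat) U W psi phi,
    [/\ (d <= n)%N, U x, C2_diffeo U W psi phi &
        forall y, U y ->
          (M y <-> forall i : 'I_n, (d <= i)%N -> psi y i 0 = 0)].

(* Velocities at x of the C^1 curves of M passing through x. *)
Definition tangent_space M x : set E :=
  [set v | exists (c : K -> E) (e : K),
    [/\ 0 < e, Ck 1 `]-e, e[ c, c @` `]-e, e[ `<=` M,
        c 0 = x & 'd c 0 1 = v]].

(* The restriction of F to M is C^2 around x: it agrees, on M near x, with a
   real-valued function that is C^2 on a neighbourhood of x in R^n. *)
Definition C2_restricted_around (F : E -> \bar K) M x : Prop :=
  exists (U : set E) (g : E -> K),
    [/\ open U, U x, Ck 2 U g & forall y, U y -> M y -> F y = (g y)%:E].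

(* Painleve-Kuratowski limits of the set-valued map S as y -> x within M. *)
Definition outer_limit (S : E -> set E) M x : set E :=
  [set v | forall U B, nbhs x U -> nbhs v B ->
     exists y, [/\ U y, M y & S y `&` B !=set0]].

Definition inner_limit (S : E -> set E) M x : set E :=
  [set v | forall B, nbhs v B ->
     \forall y \near x, M y -> S y `&` B !=set0].

Definition setvalued_continuous (S : E -> set E) M x : Prop :=
  outer_limit S M x `<=` S x /\ S x `<=` inner_limit S M x.

Record partly_smooth (F : E -> \bar K) M x : Prop := PartlySmooth {
  ps_manifold : C2_manifold_around M x;
  ps_smoothness : C2_restricted_around F M x;
  ps_sharpness : tangent_space M x = orth (par (subdiff F x));
  ps_continuity : setvalued_continuous (subdiff F) M x
}.

End Manifolds.

(* Main.v *)
(* The Douglas-Rachford map T is firmly nonexpansive and, thanks to the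
   qualification condition on the relative interiors, has a fixed point; Fejer
   monotonicity and compactness then give convergence of z_k.

   For the linearisation it is enough that prox_{gamma F} be strictly
   differentiable at a non-degenerate point wb, with xb = prox_{gamma F}(wb).
   Let x(w) minimise F + |. - w|^2 / (2 gamma) over a compact piece of the
   manifold M around xb.  Then (w - x(w)) / gamma is a subgradient of F at x(w)
   once w is close to wb: otherwise the unit directions e from its projection on
   the subdifferential towards it are normal to M, and a cluster point of them is
   normal to M at xb and supports the subdifferential at xb at a relative interior
   point, hence is also tangent to M by sharpness, which is absurd.  So
   prox(w) = x(w) lies in M.
   In a chart phi of M, with F = g on M, the first-order conditions
   <gamma grad g(x) + x - w, D phi e_i> = 0, for x = prox(w), and the equations of
   M linearise at (xb, wb) to A dx = B dw, with A injective by quadratic growth.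
   Since prox is already known to be Lipschitz, A^-1 B is its strict derivative:
   no implicit function theorem is needed. *)
Require Import Defs.
From HB Require Import structures.
From mathcomp Require Import all_boot all_order all_algebra.
From mathcomp Require Import all_classical all_reals all_analysis.
From mathcomp Require Import finmap ring lra.
Set Implicit Arguments.
Unset Strict Implicit.
Unset Printing Implicit Defensive.
Import Order.TTheory GRing.Theory Num.Theory.
Import numFieldNormedType.Exports.

Local Open Scope classical_set_scope.
Local Open Scope ring_scope.

(** * Euclidean space *)

(** Differentiability of [F_DR] at the limit z* would only give an error o(|z_k - z*|), which may be
    far larger than |z_k - z_(k-1)|. Hence the use of strict differentiability, where two points
    move independently: it survives composition with Lipschitz maps and yields M_DR = I + D_R (2 D_J
    - I) - D_J. The optimality system is posed in R^n, not in chart coordinates. With tau_i(x) the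
    i-th tangent vector of the chart at x, the tangency condition reads r_i(x) = <w - wb, tau_i(x)>,
    where r_i does not involve w. Since w - wb tends to 0 and tau_i is Lipschitz near xb, only
    tau_i(xb) enters the linearisation of the right-hand side. The d tangency conditions and the n -
    d slice equations form a square system, so injectivity is enough to invert its matrix. *)

Section EuclideanTheory.
Context {K : realType} {n : nat}.
Local Notation E := 'cV[K]_n.
Implicit Types (u v w x y z : E) (t : K).

Lemma dotC u v : dot u v = dot v u.
Proof. by apply: eq_bigr => i _; rewrite mulrC. Qed.

Lemma dotDl u v w : dot (u + v) w = dot u w + dot v w.
Proof. by rewrite /dot -big_split; apply: eq_bigr => i _; rewrite mxE mulrDl. Qed.

Lemma dotZl t u v : dot (t *: u) v = t * dot u v.
Proof. by rewrite /dot mulr_sumr; apply: eq_bigr => i _; rewrite mxE mulrA. Qed.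

Lemma dotNl u v : dot (- u) v = - dot u v.
Proof. by rewrite -scaleN1r dotZl mulN1r. Qed.

Lemma dotDr u v w : dot w (u + v) = dot w u + dot w v.
Proof. by rewrite dotC dotDl !(dotC w). Qed.

Lemma dotZr t u v : dot v (t *: u) = t * dot v u.
Proof. by rewrite dotC dotZl dotC. Qed.

Lemma dotNr u v : dot v (- u) = - dot v u.
Proof. by rewrite dotC dotNl dotC. Qed.

Lemma dot0l v : dot 0 v = 0.
Proof. by rewrite -(scale0r 0) dotZl mul0r. Qed.

Lemma dot0r v : dot v 0 = 0.
Proof. by rewrite dotC dot0l. Qed.

Definition dotE := (dotDl, dotDr, dotNl, dotNr, dotZl, dotZr, dot0l, dot0r).

Lemma dot_suml (I : Type) (r : seq I) (P : pred I) (f : I -> E) v :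
  dot (\sum_(i <- r | P i) f i) v = \sum_(i <- r | P i) dot (f i) v.
Proof. by elim/big_rec2: _ => [|i a b _ <-]; rewrite ?dot0l ?dotDl. Qed.

Lemma dot_ge0 v : 0 <= dot v v.
Proof. by apply: sumr_ge0 => i _; rewrite -expr2 sqr_ge0. Qed.

Lemma dot_eq0 v : (dot v v == 0) = (v == 0).
Proof.
apply/eqP/eqP => [/eqP|->]; last exact: dot0l.
rewrite psumr_eq0 => [/allP v0|i _]; last by rewrite -expr2 sqr_ge0.
apply/matrixP => i j; rewrite (ord1 j) mxE; apply/eqP.
by have := v0 i (mem_index_enum _); rewrite implyTb -expr2 sqrf_eq0.
Qed.

Lemma dot_delta v i : dot v (delta_mx i 0) = v i 0.
Proof.
rewrite /dot (bigD1 i) //= mxE !eqxx mulr1 big1 ?addr0 // => j ji.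
by rewrite mxE (negPf ji) mulr0.
Qed.

Lemma enorm_ge0 v : 0 <= enorm v.
Proof. exact: sqrtr_ge0. Qed.

Lemma sqr_enorm v : enorm v ^+ 2 = dot v v.
Proof. by rewrite sqr_sqrtr // dot_ge0. Qed.

Lemma enorm_eq0 v : (enorm v == 0) = (v == 0).
Proof. by rewrite -(sqrf_eq0 (enorm v)) sqr_enorm dot_eq0. Qed.

Lemma enorm_gt0 v : (0 < enorm v) = (v != 0).
Proof. by rewrite lt_neqAle eq_sym enorm_eq0 enorm_ge0 andbT. Qed.

Lemma enorm0 : enorm (0 : E) = 0.
Proof. by apply/eqP; rewrite enorm_eq0. Qed.

Lemma enormN v : enorm (- v) = enorm v.
Proof. by rewrite /enorm !dotE opprK. Qed.

Lemma enormBC u v : enorm (u - v) = enorm (v - u).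
Proof. by rewrite -enormN opprB. Qed.

Lemma enormZ t v : enorm (t *: v) = `|t| * enorm v.
Proof. by rewrite /enorm !dotE mulrA -expr2 sqrtrM ?sqr_ge0 // sqrtr_sqr. Qed.

Lemma CauchySchwarz_dot u v : dot u v <= enorm u * enorm v.
Proof.
have [->|u0] := eqVneq u 0; first by rewrite dot0l enorm0 mul0r.
have [->|v0] := eqVneq v 0; first by rewrite dot0r enorm0 mulr0.
have a0 : 0 < enorm u by rewrite enorm_gt0.
have b0 : 0 < enorm v by rewrite enorm_gt0.
(* Expanded, this square is 2 |u| |v| (|u| |v| - <u, v>). *)
have := dot_ge0 (enorm v *: u - enorm u *: v).
rewrite !dotE (dotC v u) -!sqr_enorm => H.
have ab : 0 < enorm u * enorm v by rewrite mulr_gt0.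
rewrite -(ler_pM2l ab); nra.
Qed.

Lemma abs_dot_le u v : `|dot u v| <= enorm u * enorm v.
Proof.
rewrite ler_norml CauchySchwarz_dot andbT lerNl -dotNl -(enormN u).
exact: CauchySchwarz_dot.
Qed.

Lemma enormD u v : enorm (u + v) <= enorm u + enorm v.
Proof.
rewrite -(@ler_pXn2r _ 2) ?nnegrE ?addr_ge0 ?enorm_ge0 //.
rewrite sqr_enorm !dotE (dotC v u) sqrrD !sqr_enorm.
have := CauchySchwarz_dot u v; lra.
Qed.

Lemma enormB u v : enorm (u - v) <= enorm u + enorm v.
Proof. by rewrite -(enormN v) enormD. Qed.

Lemma enorm_triangle u v w : enorm (u - w) <= enorm (u - v) + enorm (v - w).
Proof. by apply: le_trans (enormD _ _); rewrite addrA subrK. Qed.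

Lemma enorm_dist u v : `|enorm u - enorm v| <= enorm (u - v).
Proof.
have h1 : enorm u <= enorm (u - v) + enorm v.
  by apply: le_trans (enormD _ _); rewrite subrK.
have h2 : enorm v <= enorm (u - v) + enorm u.
  by rewrite enormBC; apply: le_trans (enormD _ _); rewrite subrK.
rewrite ler_norml; lra.
Qed.

Lemma enorm_sum (I : Type) (r : seq I) (P : pred I) (f : I -> E) :
  enorm (\sum_(i <- r | P i) f i) <= \sum_(i <- r | P i) enorm (f i).
Proof.
elim/big_rec2: _ => [|i a b _ ab]; first by rewrite enorm0.
by apply: le_trans (enormD _ _) _; rewrite lerD2l.
Qed.

Lemma coord_le_enorm v i : `|v i 0| <= enorm v.
Proof.
rewrite -(@ler_pXn2r _ 2) ?nnegrE ?enorm_ge0 // sqr_enorm real_normK ?num_real //.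
rewrite /dot (bigD1 i) //= expr2 lerDl sumr_ge0 // => j _.
by rewrite -expr2 sqr_ge0.
Qed.

Lemma norm_le_enorm v : `|v| <= enorm v.
Proof.
rewrite /Num.norm /= mx_normrE; apply: bigmax_le; first exact: enorm_ge0.
by move=> [i j] _ /=; rewrite (ord1 j) coord_le_enorm.
Qed.

Lemma coord_le_norm v i : `|v i 0| <= `|v|.
Proof.
rewrite [leRHS]/Num.norm /= mx_normrE.
exact: (le_bigmax _ (fun ij : 'I_n * 'I_1 => `|v ij.1 ij.2|) (i, 0)).
Qed.

Lemma enorm_le_sum v : enorm v <= \sum_i `|v i 0|.
Proof.
have s0 : 0 <= \sum_i `|v i 0| by apply: sumr_ge0.
rewrite -(@ler_pXn2r _ 2) ?nnegrE ?enorm_ge0 // sqr_enorm expr2 mulr_sumr.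
apply: ler_sum => i _; rewrite -expr2 -real_normK ?num_real // expr2 ler_wpM2r //.
by rewrite (bigD1 i) //= lerDl sumr_ge0.
Qed.

Lemma enorm_le_norm v : enorm v <= n%:R * `|v|.
Proof.
apply: le_trans (enorm_le_sum _) _.
have -> : n%:R * `|v| = \sum_(i < n) `|v| by rewrite sumr_const card_ord mulr_natl.
by apply: ler_sum => i _; exact: coord_le_norm.
Qed.

(** The library topology comes from the sup norm; the two inequalities between it and [enorm] allow
    Euclidean balls to be used from here on. The divisor is [n.+1] so that it stays positive when n
    = 0. *)
Lemma nbhs_enormP x (A : set E) :
  nbhs x A <-> exists2 e, 0 < e & forall y, enorm (y - x) < e -> A y.
Proof.
split.
  move=> /nbhs_ballP [e e0 xA]; exists e => // y yx.
  by apply: xA; rewrite -ball_normE /ball_ /= distrC; exact: le_lt_trans (norm_le_enorm _) yx.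
move=> [e e0 xA]; apply/nbhs_ballP; exists (e / n.+1%:R).
  by rewrite /= divr_gt0 // ltr0n.
move=> y; rewrite -ball_normE /ball_ /= distrC ltr_pdivlMr ?ltr0n // => yx; apply: xA.
apply: le_lt_trans (enorm_le_norm _) (le_lt_trans _ yx).
by rewrite mulrC ler_wpM2l // ler_nat.
Qed.

Lemma cvgn_enormP (z : nat -> E) x :
  z @ \oo --> x <->
  forall e, 0 < e -> exists N, forall k, (N <= k)%N -> enorm (z k - x) < e.
Proof.
split.
  move=> zx e e0; have : nbhs x [set y | enorm (y - x) < e].
    by apply/nbhs_enormP; exists e.
  by move=> /zx [N _ NA]; exists N => k Nk; exact: NA.
move=> H A /nbhs_enormP [e e0 eA]; have [N HN] := H e e0.
by exists N => // k Nk; apply: eA; exact: HN.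
Qed.

End EuclideanTheory.

(** * Compactness and attainment of minima *)

Section Compactness.
Context {K : realType} {n : nat}.
Local Notation E := 'cV[K]_n.
Implicit Types (A : set E) (u v w x y z : E).

Lemma enorm_closed A :
  (forall x, (forall e, 0 < e -> exists2 y, A y & enorm (y - x) < e) -> A x) ->
  closed A.
Proof.
move=> clA x xA; apply: clA => e e0.
have [|y [Ay yx]] := xA [set y | enorm (y - x) < e]; last by exists y.
by apply/nbhs_enormP; exists e.
Qed.

Lemma closed_cball (c : E) (C : K) : closed [set x | enorm (x - c) <= C].
Proof.
apply: enorm_closed => x xA /=; apply/ler_addgt0Pr => e e0.
have [y yC yx] := xA e e0.
apply: le_trans (enorm_triangle _ y _) _.
by rewrite addrC lerD // enormBC ltW.
Qed.

(** [bounded_closed_compact] is about row vectors, so [A] is carried there and back by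
    transposition, which is continuous. *)
Lemma closed_bounded_compact A (C : K) :
  closed A -> (forall x, A x -> enorm x <= C) -> compact A.
Proof.
move=> clA bA.
have trc m1 m2 : continuous (@trmx K m1 m2).
  move=> v B [i vi iB]; exists (fun a b => i b a) => [a b|w wi].
    by have := vi b a; rewrite mxE.
  by apply: iB => a b; rewrite mxE; exact: wi.
pose B := [set r : 'rV[K]_n | A r^T].
have cB : compact B.
  apply: bounded_closed_compact.
    exists C; split; first exact: num_real.
    move=> M CM r /bA rC; apply: le_trans (ltW CM); apply: le_trans rC.
    rewrite /Num.norm/= mx_normrE; apply: bigmax_le; first exact: enorm_ge0.
    move=> [i j] _ /=; rewrite (ord1 i); have := coord_le_enorm r^T j.
    by rewrite mxE.
  by apply: closed_comp clA => x _; exact: trc.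
have -> : A = trmx @` B.
  apply/seteqP; split=> [x Ax|_ [r Br <-]//].
  by exists x^T; rewrite /B /= trmxK.
apply: continuous_compact cB.
exact/continuous_subspaceT/trc.
Qed.

Lemma compact_cball (c : E) (C : K) : compact [set x | enorm (x - c) <= C].
Proof.
apply: (@closed_bounded_compact _ (C + enorm c)); first exact: closed_cball.
move=> x /= xC; rewrite -[x](subrK c).
by apply: le_trans (enormD _ _) _; rewrite lerD2r.
Qed.

Arguments compact_cball : clear implicits.

Lemma lsc_gt_open (F : E -> \bar K) (c : \bar K) :
  lower_semicontinuous F -> open [set x | (c < F x)%E].
Proof.
move=> lF; rewrite openE => x /= cF.
suff [a ca aF] : exists2 a : K, (c <= a%:E)%E & (a%:E < F x)%E.
  have [V xV VF] := lF x a aF.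
  by apply: filterS xV => y /VF; exact: le_lt_trans.
case: c cF => [c cF| |cF]; first by exists c.
  by rewrite ltNge leey.
case: (F x) cF => [r _| _|//]; last by exists 0; rewrite ?ltry ?leNye.
by exists (r - 1); rewrite ?leNye // lte_fin ltrBlDr ltrDl.
Qed.

(** The sublevel sets of the levels F y, for y in A, are closed, and finitely many of them meet in A
    at the chosen point of least value; compactness gives a point common to all. *)
Lemma lsc_compact_min (F : E -> \bar K) A :
  lower_semicontinuous F -> compact A -> A !=set0 ->
  exists2 x, A x & forall y, A y -> (F x <= F y)%E.
Proof.
move=> lF; rewrite compact_In0 => cA A0.
pose f y := A `&` [set x | (F x <= F y)%E].
have [||x fx] := cA E A f.
- exists (fun y => [set x | (F x <= F y)%E]) => // y _.
  rewrite -[X in closed X]setCK; apply: open_closedC.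
  rewrite (_ : ~` _ = [set x | (F y < F x)%E]); first exact: lsc_gt_open.
  by apply/seteqP; split => x /=; rewrite ltNge => /negP.
- move=> D DA.
  have : forall s : seq E, (forall y, y \in s -> A y) ->
      exists2 x, A x & forall y, y \in s -> (F x <= F y)%E.
    elim=> [_|a s IH sA]; first by case: A0 => x Ax; exists x.
    have [|x Ax xs] := IH; first by move=> y ys; apply: sA; rewrite inE ys orbT.
    have Aa : A a by apply: sA; rewrite inE eqxx.
    have [ax|/ltW xa] := leP (F a) (F x).
      exists a => // y; rewrite inE => /orP[/eqP->//|/xs]; exact: le_trans.
    by exists x => // y; rewrite inE => /orP[/eqP->//|/xs].
  move=> /(_ (enum_fset D)) [y yD|x Ax xD].
    by apply/set_mem; apply: DA.
  by exists x => y /= /xD; split.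
have [y Ay] := A0; have [Ax _] := fx y Ay.
by exists x => // z /fx [].
Qed.

Lemma bolzano (u : nat -> E) (C : K) : (forall k, enorm (u k) <= C) ->
  exists x, forall e N, 0 < e -> exists2 k, (N <= k)%N & enorm (u k - x) < e.
Proof.
move=> uC;
have [] := compact_cball 0 C (u @ \oo) _.
  by exists 0%N => // k _ /=; rewrite subr0; exact: uC.
move=> x [Ax clx]; exists x => e N e0.
have [||y [[k Nk <-] yx]] := clx (u @` [set k | (N <= k)%N]) [set y | enorm (y - x) < e].
- by exists N => // k /= Nk; exists k.
- by apply/nbhs_enormP; exists e.
by exists k.
Qed.

End Compactness.

Arguments compact_cball {K n} c C [F].

(** * Proximal maps *)

(** The passage t -> 0 shared by the first-order arguments: after division by t, the second-order
    term [t * b] disappears. *)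
Lemma ge0_affine_limit (K : realType) (a b : K) :
  (forall t, 0 < t -> t <= 1 -> 0 <= a + t * b) -> 0 <= a.
Proof.
move=> H; apply/ler_addgt0Pr => e e0.
have b1 : 0 < `|b| + 1 by rewrite ltr_wpDl.
pose t := Num.min 1 (e / (`|b| + 1)).
have t0 : 0 < t by rewrite lt_min ltr01 divr_gt0.
have t1 : t <= 1 by rewrite ge_min lexx.
have te : t * (`|b| + 1) <= e by rewrite -ler_pdivlMr // ge_min lexx orbT.
apply: le_trans (H t t0 t1) _; rewrite lerD2l; apply: le_trans te.
by rewrite ler_pM2l //; apply: le_trans (ler_norm b) _; rewrite lerDl.
Qed.

Section Prox.
Context {K : realType} {n : nat}.
Local Notation E := 'cV[K]_n.
Implicit Types (F : E -> \bar K) (u v w x y z g : E).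

Lemma enorm_continuous c : continuous (fun x : E => enorm (x - c)).
Proof.
move=> x B /nbhs_ballP [e /= e0 eB]; apply/nbhs_enormP; exists e => // y yx.
apply: eB; rewrite -ball_normE /ball_ /=; apply: le_lt_trans (enorm_dist _ _) _.
by rewrite opprB addrA subrK enormBC.
Qed.

Lemma lsc_add_continuous F (gamma : K) (h : E -> K) : 0 < gamma ->
  lower_semicontinuous F -> continuous h ->
  lower_semicontinuous (fun x => gamma%:E * F x + (h x)%:E)%E.
Proof.
move=> g0 lF ch x a.
have scale (y : E) (b : K) : ((b / gamma)%:E < F y)%E = (b%:E < gamma%:E * F y)%E.
  by rewrite EFinM -lte_pdivrMl // muleC.
rewrite -lteBlDr // -EFinB -scale => aF.
(* [b] leaves room on both sides: near x, F stays above b / gamma and h stays above a - b. *)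
have [b ab bF] : exists2 b, a - h x < b & ((b / gamma)%:E < F x)%E.
  case: (F x) aF => [r| |//]; rewrite ?lte_fin.
    rewrite ltr_pdivrMr // => aF; exists ((a - h x + r * gamma) / 2); first lra.
    by rewrite lte_fin ltr_pdivrMr //; lra.
  by move=> _; exists (a - h x + 1); rewrite ?ltry //; lra.
have [V xV VF] := lF x _ bF.
exists (V `&` [set y | a - b < h y]).
  apply: filterI => //; have abx : a - b < h x by lra.
  by apply: (cvgr_gt _ (ch x)).
move=> y [Vy hy]; rewrite -lteBlDr // -EFinB -scale.
apply: lt_trans (VF y Vy); rewrite lte_fin ltr_pM2r ?invr_gt0 //; move: hy => /=; lra.
Qed.

(** Let m be the minimum over the unit ball around a point [x0] of the domain. For d = |x - x0| > 1,
    the point of the segment at distance 1 from [x0] has value at least m, and convexity pushes this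
    bound outwards to x with slope F x0 - m. This supplies the coercivity of the prox objective. *)
Lemma convex_lower_bound F : proper_fun F -> convex_fun F ->
  lower_semicontinuous F ->
  exists x0 m c, 0 <= c /\ forall x, ((m - c * enorm (x - x0))%:E <= F x)%E.
Proof.
move=> [FNy [x0 Fx0]] cF lF.
have [x1 /= x1B x1m] : exists2 x, enorm (x - x0) <= 1 &
    forall y, enorm (y - x0) <= 1 -> (F x <= F y)%E.
  have [|x xB xm] := lsc_compact_min lF (compact_cball x0 1).
    by exists x0; rewrite /= subrr enorm0.
  by exists x.
have F10 : (F x1 <= F x0)%E by apply: x1m; rewrite subrr enorm0.
move: (FNy x0) (FNy x1) F10 Fx0; rewrite /edom /=.
case e0: (F x0) => [r0| |] //; case e1: (F x1) => [m| |] // _ _; rewrite lee_fin => mr _.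
exists x0, m, (r0 - m); rewrite subr_ge0; split => // x.
case ex: (F x) (FNy x) => [b| |] // _; last by rewrite leey.
rewrite lee_fin.
have d0 := enorm_ge0 (x - x0).
have [d1|d1] := leP (enorm (x - x0)) 1.
  have := x1m x d1; rewrite e1 ex lee_fin; nra.
set d := enorm (x - x0) in d0 d1 *.
have dp : 0 < d by lra.
have t01 : 0 <= d^-1 <= 1 by rewrite invr_ge0 d0 invf_le1 // ltW.
have := cF x x0 _ t01; rewrite e0 ex => H.
have : enorm ((d^-1 *: x + (1 - d^-1) *: x0) - x0) <= 1.
  rewrite (_ : _ - _ = d^-1 *: (x - x0)); last first.
    by apply/matrixP => i j; rewrite !mxE; ring.
  by rewrite enormZ ger0_norm ?invr_ge0 // mulVf // gt_eqF.
move=> /x1m; rewrite e1 => /le_trans/(_ H).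
rewrite -!EFinM -EFinD lee_fin => {}H.
have : d * m <= d * (d^-1 * b + (1 - d^-1) * r0) by rewrite ler_pM2l.
rewrite mulrDr mulrA divff ?gt_eqF // mul1r mulrA mulrBr mulr1 divff ?gt_eqF //.
nra.
Qed.

Lemma subdiff_fin F x g : proper_fun F -> subdiff F x g ->
  exists r, F x = r%:E.
Proof.
move=> [FNy [x0]]; rewrite /edom /= => Fx0 /(_ x0).
case: (F x) (FNy x) => [r| |] //; first by exists r.
by move=> _; rewrite leNgt /= Fx0.
Qed.

Lemma prox_exists F (gamma : K) w : proper_fun F -> convex_fun F ->
  lower_semicontinuous F -> 0 < gamma ->
  exists p, argmin (fun x => gamma%:E * F x + (2^-1 * enorm (x - w) ^+ 2)%:E)%E p.
Proof.
move=> pF cF lF g0; have [x0 [m [c [c0 Fm]]]] := convex_lower_bound pF cF lF.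
have [FNy [x1 Fx1]] := pF; set G := (X in argmin X).
have lG : lower_semicontinuous G.
  apply: lsc_add_continuous => // x; have cw := @enorm_continuous w x.
  exact: (continuousM (@cst_continuous _ _ (2^-1 : K) x) (continuousM cw cw)).
have [r Fr] : exists r, F x1 = r%:E.
  by move: Fx1 (FNy x1); rewrite /edom /=; case: (F x1) => [r| |] //; exists r.
pose v0 := gamma * r + 2^-1 * enorm (x1 - w) ^+ 2.
have Gx1 : G x1 = v0%:E by rewrite /G Fr.
pose k := `|v0 - gamma * m + gamma * c * enorm (w - x0)|.
(* For d = |y - w| > rho, half of d^2 exceeds gamma c d + k + 1, so the objective is above its value
   [v0] at [x1] in spite of the conic lower bound; the last summand puts [x1] in the ball. *)
pose rho := 2 * (gamma * c) + 2 * k + 2 + enorm (x1 - w).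
have x1rho : enorm (x1 - w) <= rho.
  have k0 : 0 <= k by exact: normr_ge0.
  have gc0 : 0 <= gamma * c by rewrite mulr_ge0 // ltW.
  rewrite /rho; lra.
have [p /= _ pmin] := lsc_compact_min lG (compact_cball w rho) (ex_intro _ x1 x1rho).
exists p => y; have [/pmin //|yrho] := leP (enorm (y - w)) rho.
apply: le_trans (pmin _ x1rho) _; rewrite Gx1.
apply: (@le_trans _ _ (gamma * (m - c * enorm (y - x0)) + 2^-1 * enorm (y - w) ^+ 2)%:E).
  rewrite lee_fin.
  have gc0 : 0 <= gamma * c by rewrite mulr_ge0 // ltW.
  have kv : v0 - gamma * m + gamma * c * enorm (w - x0) <= k by exact: ler_norm.
  have k0 : 0 <= k by exact: normr_ge0.
  have h1 := enorm_triangle y w x0.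
  have h2 : gamma * c * enorm (y - x0) <= gamma * c * (enorm (y - w) + enorm (w - x0)).
    by rewrite ler_wpM2l.
  have h3 := enorm_ge0 (x1 - w).
  move: yrho; rewrite /rho; move: (enorm (y - w)) h2 => d h2 yrho.
  have : d * (2 * (gamma * c) + 2 * k + 2) <= d * d by rewrite ler_wpM2l; lra.
  have : 1 * (2 * k + 2) <= d * (2 * k + 2) by rewrite ler_wpM2r; lra.
  nra.
by rewrite /G EFinD leeD2r // EFinM lee_pmul2l.
Qed.

(** Compare p with t y + (1 - t) p and use convexity of F; after division by t the quadratic term
    contributes <p - w, y - p> plus a multiple of t. *)
Lemma argmin_prox_subdiff F (gamma : K) w p : proper_fun F -> convex_fun F ->
  0 < gamma ->
  argmin (fun x => gamma%:E * F x + (2^-1 * enorm (x - w) ^+ 2)%:E)%E p ->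
  subdiff F p (gamma^-1 *: (w - p)).
Proof.
move=> [FNy [x1 Fx1]] cF g0 pmin y.
have [r Fr] : exists r, F p = r%:E.
  move: (pmin x1) Fx1 (FNy x1) (FNy p); rewrite /edom /=.
  case: (F x1) => [r1| |] //; case: (F p) => [r| |] //; first by exists r.
  by rewrite gt0_muley.
case Fy: (F y) (FNy y) => [b| |] // _; last by rewrite leey.
rewrite Fr -EFinD lee_fin dotZl -lerBrDl ler_pdivrMl // -subr_ge0.
apply: (@ge0_affine_limit _ _ (dot (y - p) (y - p) / 2)) => t t0 t1.
have := pmin (t *: y + (1 - t) *: p); rewrite Fr => H.
have t01 : 0 <= t <= 1 by rewrite ltW.
have := cF y p t t01; rewrite Fy Fr -!EFinM -EFinD => H2.
have {}H : ((gamma * r + 2^-1 * enorm (p - w) ^+ 2)%:E <=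
  (gamma * (t * b + (1 - t) * r) + 2^-1 * enorm (t *: y + (1 - t) *: p - w) ^+ 2)%:E)%E.
  rewrite EFinD EFinM; apply: le_trans H _.
  by rewrite EFinD leeD2r // EFinM lee_pmul2l.
move: H; rewrite lee_fin.
rewrite (_ : t *: y + _ - w = (p - w) + t *: (y - p)); last first.
  by apply/matrixP => i j; rewrite !mxE; ring.
rewrite !sqr_enorm.
have -> : dot (p - w + t *: (y - p)) (p - w + t *: (y - p)) =
  dot (p - w) (p - w) - 2 * t * dot (w - p) (y - p) + t ^+ 2 * dot (y - p) (y - p).
  rewrite -(opprB p w).
  by move: (p - w) (y - p) => a c; rewrite !dotE (dotC c a); ring.
move: (dot (p - w) (p - w)) (dot (w - p) (y - p)) (dot (y - p) (y - p)) => a c D H.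
by rewrite -(pmulr_rge0 _ t0); move: H; rewrite expr2; lra.
Qed.

(** The subgradient inequality plus the exact expansion of |y - w|^2 around p. The surplus |y - p|^2
    / 2 gives uniqueness of the prox; later it also keeps minimisers on the manifold close to xb and
    makes the linearised system injective. *)
Lemma subdiff_growth F (gamma : K) w p : 0 < gamma ->
  proper_fun F -> subdiff F p (gamma^-1 *: (w - p)) ->
  forall y, (gamma%:E * F p + (2^-1 * enorm (p - w) ^+ 2)%:E +
    (2^-1 * enorm (y - p) ^+ 2)%:E <= gamma%:E * F y + (2^-1 * enorm (y - w) ^+ 2)%:E)%E.
Proof.
move=> g0 pF sF y; have [r Fr] := subdiff_fin pF sF.
have := sF y; rewrite Fr; case Fy: (F y) (pF.1 y) => [b| |] // _; last first.
  by rewrite gt0_muley ?lte_fin // addye ?leey.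
rewrite -!EFinM -!EFinD !lee_fin dotZl -lerBrDl ler_pdivrMl // !sqr_enorm.
rewrite (_ : y - w = (y - p) - (w - p)); last by rewrite opprB addrA subrK.
rewrite -(opprB w p).
move: (w - p) (y - p) => a c; rewrite !dotE (dotC c a).
by rewrite mulrBr; move: (dot a a) (dot a c) (dot c c) => aa ac cc; lra.
Qed.

(** The means of computing a value of [prox]: exhibit a point with the right subgradient. Growth
    makes the minimiser unique, so [xget] returns it and not its default. *)
Lemma prox_eq F (gamma : K) w p : 0 < gamma -> proper_fun F ->
  subdiff F p (gamma^-1 *: (w - p)) -> prox gamma F w = p.
Proof.
move=> g0 pF sF; have growth := subdiff_growth g0 pF sF.
have [r Fr] := subdiff_fin pF sF.
apply: xget_unique => [y|y ymin].
  apply: le_trans (growth y); rewrite Fr -EFinM -!EFinD lee_fin lerDl.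
  by rewrite mulr_ge0 // sqr_ge0.
have := le_trans (growth y) (ymin p); rewrite Fr -!EFinM -!EFinD lee_fin.
rewrite gerDl pmulr_rle0 ?invr_gt0 // sqr_enorm => yp.
by apply/eqP; rewrite -subr_eq0 -dot_eq0 eq_le yp dot_ge0.
Qed.

Lemma prox_subdiff F (gamma : K) w : proper_fun F -> convex_fun F ->
  lower_semicontinuous F -> 0 < gamma ->
  subdiff F (prox gamma F w) (gamma^-1 *: (w - prox gamma F w)).
Proof.
move=> pF cF lF g0; have [p pmin] := prox_exists w pF cF lF g0.
have sF := argmin_prox_subdiff pF cF g0 pmin.
by rewrite (prox_eq g0 pF sF).
Qed.

Lemma subdiff_monotone F x y g h : proper_fun F ->
  subdiff F x g -> subdiff F y h -> 0 <= dot (g - h) (x - y).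
Proof.
move=> pF gx hy.
have [a Fx] := subdiff_fin pF gx; have [b Fy] := subdiff_fin pF hy.
have := gx y; have := hy x; rewrite Fx Fy -!EFinD !lee_fin.
rewrite -(opprB x y) !dotE; lra.
Qed.

Section ProxOperator.
Context (F : E -> \bar K) (gamma : K).
Hypotheses (pF : proper_fun F) (cF : convex_fun F).
Hypotheses (lF : lower_semicontinuous F) (g0 : 0 < gamma).
Local Notation P := (prox gamma F).

(** Monotonicity of the subdifferential at the subgradients (w - P w) / gamma and (w' - P w') /
    gamma. *)
Lemma prox_firm w w' : dot (P w - P w') (P w - P w') <= dot (P w - P w') (w - w').
Proof.
have := subdiff_monotone pF (prox_subdiff w pF cF lF g0) (prox_subdiff w' pF cF lF g0).
rewrite -scalerBr dotZl pmulr_rge0 ?invr_gt0 //.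
rewrite (_ : w - P w - (w' - P w') = (w - w') - (P w - P w')); last first.
  by apply/matrixP => i j; rewrite !mxE; ring.
by rewrite dotDl dotNl subr_ge0 (dotC (w - w')).
Qed.

Lemma prox_nonexpansive w w' : enorm (P w - P w') <= enorm (w - w').
Proof.
have [->|] := eqVneq (P w - P w') 0; first by rewrite enorm0 enorm_ge0.
rewrite -enorm_gt0 => h; rewrite -(ler_pM2l h).
apply: le_trans (CauchySchwarz_dot _ _).
by rewrite -expr2 sqr_enorm prox_firm.
Qed.

End ProxOperator.

(** The projection is the prox of the indicator function of S, and its variational inequality is the
    subgradient inequality of that function at q. *)
Lemma projection_convex (S : set E) v : closed S -> S !=set0 ->
  (forall x y t, 0 <= t <= 1 -> S x -> S y -> S (t *: x + (1 - t) *: y)) ->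
  exists2 q, S q & forall p, S p -> dot (v - q) (p - q) <= 0.
Proof.
move=> clS [s0 Ss0] cS.
pose F x : \bar K := if x \in S then 0%E else +oo%E.
have pF : proper_fun F.
  split; first by move=> x; rewrite /F; case: ifP.
  by exists s0; rewrite /edom /F /= mem_set.
have cF : convex_fun F.
  move=> x y t t01; rewrite /F.
  (* At t = 0 and t = 1 the convention 0 * +oo = 0 applies; strictly between, an infinite value
     makes the right-hand side infinite. *)
  have [-> | t0] := eqVneq t 0.
    rewrite scale0r add0r subr0 scale1r mul0e add0e mul1e; exact: lexx.
  have [-> | t1] := eqVneq t 1.
    rewrite subrr scale0r addr0 scale1r mul0e adde0 mul1e; exact: lexx.
  have tp : 0 < t by case/andP: t01 => ? ?; rewrite lt_neqAle eq_sym t0.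
  have tq : 0 < 1 - t by case/andP: t01 => ? ?; rewrite subr_gt0 lt_neqAle t1.
  have [Sx|Sx] := boolP (x \in S); have [Sy|Sy] := boolP (y \in S);
    rewrite ?gt0_muley ?lte_fin // ?mule0 ?adde0 ?addye ?addey ?leey //.
  by rewrite mem_set //; apply: cS => //; exact: set_mem.
have lF : lower_semicontinuous F.
  move=> x a; rewrite /F; case: ifPn => xS.
    move=> a0; exists setT; first exact: filterT.
    by move=> y _; case: ifP => // _; rewrite ltry.
  move=> _; exists (~` S).
    by apply: open_nbhs_nbhs; split; [rewrite openC|move=> /mem_set; exact/negP].
  by move=> y /= yS; rewrite memNset // ltry.
have := prox_subdiff v pF cF lF (ltr01 : 0 < 1).
rewrite invr1 scale1r; set q := prox _ _ _ => qs.
have Sq : S q.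
  have [r] := subdiff_fin pF qs; rewrite /F; case: ifPn => // /set_mem //.
exists q => // p Sp.
by have := qs p; rewrite /F !mem_set // add0e lee_fin.
Qed.

End Prox.

(** * Separation and the subdifferential of a sum *)

Section Separation.
Context {K : realType} {n : nat}.
Local Notation E := 'cV[K]_n.
Implicit Types (u v w x y z : E).

Lemma mulmx_colE r (B : 'M[K]_(n, r)) (c : 'cV[K]_r) :
  B *m c = \sum_j c j 0 *: col j B.
Proof.
apply/matrixP => i k; rewrite (ord1 k) !mxE summxE; apply: eq_bigr => j _.
by rewrite !mxE mulrC.
Qed.

Lemma mulmx_bounded r (B : 'M[K]_(n, r)) :
  exists2 C, 0 <= C & forall c : 'cV[K]_r, enorm (B *m c) <= C * enorm c.
Proof.
exists (\sum_j enorm (col j B)); first by apply: sumr_ge0 => j _; exact: enorm_ge0.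
move=> c; rewrite mulmx_colE; apply: le_trans (enorm_sum _ _ _) _.
rewrite mulr_suml; apply: ler_sum => j _; rewrite enormZ mulrC.
by rewrite ler_wpM2l ?enorm_ge0 // coord_le_enorm.
Qed.

Definition convex_set (A : set E) := forall x y t,
  0 <= t <= 1 -> A x -> A y -> A (t *: x + (1 - t) *: y).

Lemma convex_combination (A : set E) : convex_set A ->
  forall r (b : 'I_r -> E) (c : 'I_r -> K),
  (forall j, A (b j)) -> (forall j, 0 <= c j) -> \sum_j c j = 1 ->
  A (\sum_j c j *: b j).
Proof.
move=> cA; elim=> [|r IH] b c Ab c0 c1.
  by move: c1; rewrite big_ord0 => /eqP; rewrite eq_sym oner_eq0.
rewrite big_ord_recl; rewrite big_ord_recl in c1.
set s := \sum_(i < r) c (lift ord0 i) in c1 *.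
have s0 : 0 <= s by apply: sumr_ge0.
have [sz|sp] := eqVneq s 0.
  have -> : c ord0 = 1 by rewrite -c1 sz addr0.
  rewrite scale1r big1 ?addr0 // => i _.
  move/eqP: sz; rewrite psumr_eq0 // => /allP /(_ i (mem_index_enum _)).
  by rewrite implyTb => /eqP ->; rewrite scale0r.
have s_gt0 : 0 < s by rewrite lt_neqAle eq_sym sp.
pose c' j := s^-1 * c (lift ord0 j).
have Ac' : A (\sum_j c' j *: b (lift ord0 j)).
  apply: (IH (fun j => b (lift ord0 j))) => // [j|].
    by rewrite mulr_ge0 // invr_ge0.
  by rewrite -mulr_sumr mulVf.
have -> : \sum_(i < r) c (lift ord0 i) *: b (lift ord0 i) =
    (1 - c ord0) *: \sum_j c' j *: b (lift ord0 j).
  rewrite scaler_sumr; apply: eq_bigr => j _; rewrite scalerA; congr (_ *: _).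
  by rewrite -c1 addrAC subrr add0r mulrA mulfV // mul1r.
apply: cA => //; rewrite c0 /= -c1 lerDl //.
Qed.

Definition simplex r : set 'cV[K]_r :=
  [set c | (forall j, 0 <= c j 0) /\ \sum_j c j 0 = 1].

Lemma simplex_compact r : compact (@simplex r).
Proof.
apply: (@closed_bounded_compact _ _ _ 1).
  apply: enorm_closed => x xA.
  have close e : 0 < e -> exists2 y, simplex y & forall j, `|y j 0 - x j 0| < e.
    move=> /xA [y yA yx]; exists y => // j.
    by have := coord_le_enorm (y - x) j; rewrite !mxE => /le_lt_trans; exact.
  split.
    move=> j; apply/ler_addgt0Pr => e /close [y [y0 _]] /(_ j).
    rewrite ltr_norml => /andP[_]; have := y0 j; lra.
  apply/eqP; rewrite -subr_eq0 -normr_le0; apply/ler_addgt0Pr => e e0; rewrite add0r.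
  have r0 : 0 < r.+1%:R :> K by rewrite ltr0n.
  have [|y [_ y1] yx] := close (e / r.+1%:R); first by rewrite divr_gt0.
  rewrite -y1 -sumrB; apply: le_trans (ler_norm_sum _ _ _) _.
  apply: (@le_trans _ _ (\sum_(j < r) e / r.+1%:R)).
    by apply: ler_sum => j _; rewrite distrC ltW.
  rewrite sumr_const card_ord -[leLHS]mulr_natr -mulrA ger_pMr //.
  by rewrite mulrC ler_pdivrMr // mul1r ler_nat.
move=> x [x0 x1]; apply: le_trans (enorm_le_sum _) _; rewrite -x1.
by apply: ler_sum => j _; rewrite ger0_norm.
Qed.

(* [q] is the point of least norm in the convex hull of the family [b]. *)
Lemma convex_hull_min_norm (A : set E) : convex_set A ->
  forall r (b : 'I_r.+1 -> E), (forall j, A (b j)) ->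
  exists2 q, A q & forall j, dot q q <= dot q (b j).
Proof.
move=> cA r b Ab; pose B := \matrix_(i, j) b j i 0.
have colB j : col j B = b j.
  by apply/matrixP => i k; rewrite (ord1 k) !mxE.
have [C C0 BC] := mulmx_bounded B.
pose F (c : 'cV[K]_r.+1) := (enorm (B *m c))%:E.
have lF : lower_semicontinuous F.
  move=> x a; rewrite /F lte_fin => ax.
  exists [set y | enorm (y - x) < (enorm (B *m x) - a) / (C + 1)].
    apply/nbhs_enormP; exists ((enorm (B *m x) - a) / (C + 1)) => //.
    by rewrite divr_gt0; lra.
  move=> y /=; rewrite lte_fin ltr_pdivlMr; last by lra.
  have := enorm_dist (B *m x) (B *m y); rewrite -mulmxBr.
  have := BC (x - y); rewrite (enormBC x y) ler_norml => h1 /andP[_ h2].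
  have h3 := enorm_ge0 (y - x); move: h1 h2 h3.
  move: (enorm (y - x)) (enorm _) (enorm _) (enorm _) => d p q s; nra.
have S0 : simplex (delta_mx (ord0 : 'I_r.+1) 0).
  split=> [j|]; first by rewrite mxE ler0n.
  rewrite (bigD1 ord0) //= mxE !eqxx big1 ?addr0 // => j j0.
  by rewrite mxE (negPf j0).
have [c Sc cmin] := lsc_compact_min lF (@simplex_compact r.+1) (ex_intro _ _ S0).
pose q := B *m c.
have Bc (c' : 'cV[K]_r.+1) : B *m c' = \sum_j c' j 0 *: b j.
  by rewrite mulmx_colE; apply: eq_bigr => j _; rewrite colB.
exists q; first by rewrite /q Bc; apply: convex_combination Sc.1 Sc.2.
move=> j; rewrite -subr_ge0.
suff : 0 <= 2 * (dot q (b j) - dot q q) by rewrite pmulr_rge0.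
apply: (@ge0_affine_limit _ _ (dot (b j - q) (b j - q))) => t t0 t1.
have St : simplex ((1 - t) *: c + t *: delta_mx j 0).
  have [c0 c1] := Sc; split=> [i|].
    by rewrite !mxE addr_ge0 // mulr_ge0 ?ler0n ?subr_ge0 // ltW.
  under eq_bigr do rewrite !mxE.
  rewrite big_split /= -!mulr_sumr c1 mulr1 (bigD1 j) //= !eqxx big1 ?addr0.
    by rewrite mulr1 subrK.
  by move=> i ij; rewrite (negPf ij).
have Bt : B *m ((1 - t) *: c + t *: delta_mx j 0) = q + t *: (b j - q).
  rewrite mulmxDr -!scalemxAr -/q -colE colB.
  by apply/matrixP => i k; rewrite !mxE; ring.
have := cmin _ St; rewrite /F Bt lee_fin -/q => h.
have : dot q q <= dot (q + t *: (b j - q)) (q + t *: (b j - q)).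
  by rewrite -!sqr_enorm ler_sqr ?nnegrE ?enorm_ge0.
move: (b j) => a; rewrite !dotE (dotC a q).
move: (dot q q) (dot q a) (dot a a) => qq qa aa {}h.
have : 0 <= t * (2 * (qa - qq) + t * (aa - qa - (qa - qq))) by nra.
by rewrite pmulr_rge0 //; lra.
Qed.

(** For finitely many points of A, the least-norm point of their hull gives a direction that is
    nonnegative on them; compactness of the closure [C0] of the directions of A then gives one l
    valid for all of A. Taking [C0] and not the whole sphere is what makes the separation proper. *)
Lemma proper_separation (A : set E) : convex_set A -> A !=set0 -> ~ A 0 ->
  exists2 l, (forall a, A a -> 0 <= dot l a) & (exists2 a, A a & dot l a != 0).
Proof.
move=> cA [a0 Aa0] nA0.
pose unit_dir (q : E) : E := (enorm q)^-1 *: q.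
pose C0 := closure (unit_dir @` A).
have nz q : A q -> 0 < enorm q.
  by move=> Aq; rewrite enorm_gt0; apply/eqP => q0; apply: nA0; rewrite -q0.
have unit1 q : A q -> enorm (unit_dir q) = 1.
  move=> /nz q0; rewrite /unit_dir enormZ ger0_norm ?invr_ge0 ?ltW //.
  by rewrite mulVf // gt_eqF.
have cC0 : compact C0.
  apply: (subclosed_compact _ (compact_cball (0 : E) 1)); first exact: closed_closure.
  have /closure_id -> := @closed_cball K n 0 1; apply: closureS.
  by move=> _ [q Aq <-] /=; rewrite subr0 unit1.
move: cC0; rewrite compact_In0 => cC0.
have [||l Hl] := cC0 E A (fun a => C0 `&` [set l | 0 <= dot l a]).
- exists (fun a => [set l | 0 <= dot l a]) => // a _.
  apply: enorm_closed => x xA /=; apply/ler_addgt0Pr => e e0.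
  have a1 : 0 < enorm a + 1 by rewrite ltr_wpDl ?enorm_ge0.
  have [y ya yx] := xA (e / (enorm a + 1)) (divr_gt0 e0 a1).
  move: yx; rewrite ltr_pdivlMr // => yx.
  have := CauchySchwarz_dot (y - x) a; rewrite dotDl dotNl.
  move: ya => /=; have := enorm_ge0 (y - x); nra.
- move=> D DA.
  pose b j : E := nth a0 (a0 :: enum_fset D) j.
  have Ab (j : 'I_(size (enum_fset D)).+1) : A (b j).
    have : b j \in a0 :: enum_fset D by rewrite mem_nth.
    by rewrite inE => /orP[/eqP ->//|/DA /set_mem].
  have [q Aq qb] := convex_hull_min_norm cA Ab.
  exists (unit_dir q) => a aD; split.
    by apply: subset_closure; exists q.
  rewrite /unit_dir /= dotZl mulr_ge0 ?invr_ge0 ?enorm_ge0 //.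
  have aD' : a \in a0 :: enum_fset D by rewrite inE aD orbT.
  have sz : (index a (a0 :: enum_fset D) < (size (enum_fset D)).+1)%N.
    by rewrite -[X in (_ < X)%N]/(size (a0 :: _)) index_mem.
  have ba : b (Ordinal sz) = a := nth_index a0 aD'.
  by have := qb (Ordinal sz); rewrite ba; apply: le_trans; exact: dot_ge0.
exists l; first by move=> a /Hl [].
(* Were l zero on A, it would be orthogonal to every [unit_dir q]; but it is within 1/2 of one of
   them, which forces both |l| <= 1/2 and |l| > 1/2. *)
apply: contrapT => lA0.
have la0 a : A a -> dot l a = 0.
  by move=> Aa; apply/eqP; apply: contrapT => /negP la; apply: lA0; exists a.
have [C0l _] := Hl _ Aa0.
have [|_ [[q Aq <-] /= ql]] := C0l [set y | enorm (y - l) < 2^-1].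
  by apply/nbhs_enormP; exists 2^-1.
have h1 := unit1 q Aq.
have lq : dot l (unit_dir q) = 0 by rewrite dotZr la0 // mulr0.
have h2 := enorm_dist (unit_dir q) l.
have h3 := CauchySchwarz_dot l (l - unit_dir q).
move: h3; rewrite dotDr dotNr lq subr0 -sqr_enorm enormBC.
move: h2; rewrite h1 ler_norml; have := enorm_ge0 l; nra.
Qed.

(** The prolonged point is an affine combination of x and y, hence in the affine hull, and [eta]
    keeps it in the ball around y where points of the hull belong to S. *)
Lemma ri_extend (S : set E) y x : ri S y -> S x ->
  exists2 eta, 0 < eta & S (y + eta *: (y - x)).
Proof.
move=> [Sy /nbhs_enormP [e e0 eS]] Sx.
have k0 : 0 < enorm (y - x) + 1 by rewrite ltr_wpDl ?enorm_ge0.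
pose eta := e / (enorm (y - x) + 1).
have eta0 : 0 < eta by rewrite divr_gt0.
exists eta => //; apply: eS.
  rewrite addrAC subrr add0r enormZ gtr0_norm // /eta -mulrA gtr_pMr //.
  by rewrite mulrC ltr_pdivrMr // mul1r ltrDl.
move=> H [aH SH].
rewrite (_ : y + _ = (1 - (1 + eta)) *: x + (1 + eta) *: y).
  by apply: aH; exact: SH.
by apply/matrixP => i j; rewrite !mxE; ring.
Qed.

End Separation.

Lemma dot_col_mx (K : realType) m n (a b : 'cV[K]_m) (c d : 'cV[K]_n) :
  dot (col_mx a c) (col_mx b d) = dot a b + dot c d.
Proof.
rewrite /dot big_split_ord /=; congr (_ + _); apply: eq_bigr => i _.
  by rewrite !col_mxEu.
by rewrite !col_mxEd.
Qed.

Lemma dot_scalar_mx (K : realType) (a b : K) :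
  dot (a%:M : 'cV_1) (b%:M) = a * b.
Proof. by rewrite /dot big_ord1 !mxE eqxx !mulr1n. Qed.

(* The pairs (x - y, s) with s > R x + J y - inf (R + J) form a convex set that
   misses the origin; a vertical separating hyperplane is excluded by the common
   relative interior point. *)
Lemma subdiff_sum_at_min (K : realType) n (R J : 'cV[K]_n -> \bar K) x0 :
  proper_fun R -> convex_fun R -> proper_fun J -> convex_fun J ->
  ri (edom R) `&` ri (edom J) !=set0 ->
  argmin (fun y => R y + J y)%E x0 ->
  exists2 g, subdiff R x0 g & subdiff J x0 (- g).
Proof.
move=> [RNy _] cR [JNy _] cJ [y0 [riR riJ]] x0min.
have fin (F : 'cV[K]_n -> \bar K) (FNy : forall x, F x != -oo%E) x :
    edom F x -> exists r, F x = r%:E.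
  by move: (FNy x); rewrite /edom /=; case: (F x) => [r| |] //; exists r.
have [rR Ry0] := fin _ RNy y0 riR.1; have [rJ Jy0] := fin _ JNy y0 riJ.1.
have [r [j [Rx0 Jx0]]] : exists r j, R x0 = r%:E /\ J x0 = j%:E.
  move: (x0min y0) (RNy x0) (JNy x0); rewrite Ry0 Jy0.
  by case: (R x0) => [r| |] //; case: (J x0) => [j| |] // _ _ _; exists r, j.
have xmin x a b : R x = a%:E -> J x = b%:E -> r + j <= a + b.
  by move=> Rx Jx; have := x0min x; rewrite Rx Jx Rx0 Jx0.
pose A : set 'cV[K]_(n + 1) := [set c | exists x y a b s,
  [/\ R x = a%:E, J y = b%:E, a + b - (r + j) < s & c = col_mx (x - y) s%:M]].
have cvx F (FNy : forall x, F x != -oo%E) (cF : convex_fun F) (x y : 'cV[K]_n) a b t :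
    F x = a%:E -> F y = b%:E -> 0 <= t <= 1 ->
    exists2 c, F (t *: x + (1 - t) *: y) = c%:E & c <= t * a + (1 - t) * b.
  move=> Fx Fy /(cF x y); rewrite Fx Fy -!EFinM -EFinD.
  case: (F _) (FNy (t *: x + (1 - t) *: y)) => [c| |] //.
  by rewrite lee_fin; exists c.
have cA : convex_set A.
  move=> p q t t01 [x1 [y1 [a1 [b1 [s1 [Rx1 Jy1 h1 ->]]]]]].
  move=> [x2 [y2 [a2 [b2 [s2 [Rx2 Jy2 h2 ->]]]]]].
  have [a Ra ha] := cvx _ RNy cR _ _ _ _ _ Rx1 Rx2 t01.
  have [b Jb hb] := cvx _ JNy cJ _ _ _ _ _ Jy1 Jy2 t01.
  exists (t *: x1 + (1 - t) *: x2), (t *: y1 + (1 - t) *: y2), a, b.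
  exists (t * s1 + (1 - t) * s2); split => //.
    have [t0 t1] := andP t01.
    have k1 : 0 <= t * (s1 - (a1 + b1 - (r + j))).
      by rewrite mulr_ge0 // subr_ge0 ltW.
    have k2 : 0 <= (1 - t) * (s2 - (a2 + b2 - (r + j))).
      by rewrite mulr_ge0 // subr_ge0 // ltW.
    have : 0 < t * (s1 - (a1 + b1 - (r + j))) + (1 - t) * (s2 - (a2 + b2 - (r + j))).
      have [->|tn0] := eqVneq t 0; first by rewrite subr0 mul0r mul1r add0r subr_gt0.
      rewrite ltr_pwDl // mulr_gt0 // ?subr_gt0 //.
      by rewrite lt_neqAle eq_sym tn0.
    nra.
  rewrite !scale_col_mx add_col_mx; congr col_mx.
    by apply/matrixP => i k; rewrite !mxE; ring.
  by apply/matrixP => i k; rewrite !mxE (ord1 i) (ord1 k) eqxx !mulr1n.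
have A0 : A !=set0.
  exists (col_mx (x0 - x0) 1%:M), x0, x0, r, j, 1; split => //.
  by rewrite subrr ltr01.
have nA0 : ~ A 0.
  move=> [x [y [a [b [s [Rx Jy h]]]]]]; rewrite -col_mx0 => /eq_col_mx [xy s0].
  have xy' : x = y by apply/eqP; rewrite -subr_eq0 -xy.
  have := xmin x a b Rx; rewrite xy' => /(_ Jy).
  have : s = 0 by move/matrixP: s0 => /(_ 0 0); rewrite !mxE eqxx mulr1n => <-.
  by move=> s0'; move: h; rewrite s0'; lra.
have [l lA [_ [xa [ya [aa [ba [sa [Rxa Jya _ ->]]]]]] lne]] := proper_separation cA A0 nA0.
pose g : 'cV[K]_n := usubmx l; pose lam := dsubmx l 0 0.
have lE : l = col_mx g lam%:M by rewrite -mx11_scalar vsubmxK.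
have sep x y a b s : R x = a%:E -> J y = b%:E -> a + b - (r + j) < s ->
    0 <= dot g (x - y) + lam * s.
  move=> Rx Jy h; have := lA (col_mx (x - y) s%:M).
  by rewrite lE dot_col_mx dot_scalar_mx; apply; exists x, y, a, b, s.
have lam0 : 0 <= lam.
  have := sep x0 x0 r j 1 Rx0 Jx0; rewrite !subrr dot0r add0r mulr1; apply.
  exact: ltr01.
have [lamz|lamnz] := eqVneq lam 0.
  (* A vertical hyperplane separates the domains only. Prolonging segments through [y0], which is in
     both relative interiors, makes g constant on each domain, so l vanishes at the point of
     [lne]. *)
  have sep0 x y : edom R x -> edom J y -> 0 <= dot g (x - y).
    move=> /(fin _ RNy) [a Rx] /(fin _ JNy) [b Jy].
    have := sep x y a b (a + b - (r + j) + 1) Rx Jy.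
    by rewrite lamz mul0r addr0 ltrDl ltr01; exact.
  have gR x : edom R x -> dot g (x - y0) = 0.
    move=> Rx; have [eta eta0 Re] := ri_extend riR Rx.
    have := sep0 _ _ Re riJ.1; rewrite addrAC subrr add0r dotZr pmulr_rge0 //.
    rewrite -opprB dotNr; have := sep0 _ _ Rx riJ.1; lra.
  have gJ y : edom J y -> dot g (y0 - y) = 0.
    move=> Jy; have [eta eta0 Je] := ri_extend riJ Jy.
    have := sep0 _ _ riR.1 Je; rewrite opprD addrA subrr add0r dotNr dotZr.
    rewrite oppr_ge0 pmulr_rle0 //; have := sep0 _ _ riR.1 Jy; lra.
  case/negP: lne; rewrite lE dot_col_mx dot_scalar_mx lamz mul0r addr0.
  rewrite -(subrK y0 xa) -addrA dotDr gR ?gJ ?addr0 //.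
    by rewrite /edom /= Jya ltry.
  by rewrite /edom /= Rxa ltry.
have lamp : 0 < lam by rewrite lt_neqAle eq_sym lamnz.
(* Divide by [lam] and let s decrease to its bound; y = x0 and x = x0 then give the two subgradient
   inequalities. *)
have key x y a b : R x = a%:E -> J y = b%:E ->
    dot (- (lam^-1 *: g)) (x - y) <= a + b - (r + j).
  move=> Rx Jy; apply/ler_addgt0Pr => e e0.
  have := sep x y a b (a + b - (r + j) + e) Rx Jy; rewrite ltrDl => /(_ e0).
  rewrite dotNl dotZl -(pmulr_rge0 _ (_ : 0 < lam^-1)) ?invr_gt0 //.
  by rewrite mulrDr mulrA mulVf // mul1r; lra.
exists (- (lam^-1 *: g)) => x.
  case Rx: (R x) (RNy x) => [a| |] // _; last by rewrite leey.
  by rewrite Rx0 -EFinD lee_fin; have := key x x0 a j Rx Jx0; lra.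
case Jx: (J x) (JNy x) => [b| |] // _; last by rewrite leey.
rewrite Jx0 -EFinD lee_fin; have := key x0 x r b Rx0 Jx.
by rewrite -(opprB x x0) dotNr dotNl; lra.
Qed.

(** * Convergence of Douglas-Rachford *)

Section KrasnoselskiiMann.
Context {K : realType} {n : nat}.
Local Notation E := 'cV[K]_n.
Implicit Types (z w p : E).

Definition firmly_nonexpansive (T : E -> E) := forall z w,
  enorm (T z - T w) ^+ 2 + enorm ((z - T z) - (w - T w)) ^+ 2 <= enorm (z - w) ^+ 2.

Lemma firmly_nonexpansive_le T z w : firmly_nonexpansive T ->
  enorm (T z - T w) <= enorm (z - w).
Proof.
move=> fT; rewrite -ler_sqr ?nnegrE ?enorm_ge0 //.
by apply: le_trans (fT z w); rewrite lerDl sqr_ge0.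
Qed.

Lemma nonincreasing_steps (a : nat -> K) : (forall k, 0 <= a k) ->
  (forall k, a k.+1 <= a k) ->
  forall e, 0 < e -> exists N, forall k, (N <= k)%N -> a k - a k.+1 < e.
Proof.
move=> a0 aS e e0.
have : cvgn a.
  apply: nonincreasing_is_cvgn; first by apply/nonincreasing_seqP.
  by exists 0 => _ [k _ <-].
move=> /cvg_ex [l al]; have e2 : 0 < e / 2 by rewrite divr_gt0.
have /pseudometric_normed_Zmodule.cvgrPdist_lt /(_ _ e2) [N _ HN] := al.
exists N => k Nk; have := HN k Nk; have := HN k.+1 (leqW Nk); rewrite /= !ltr_norml; lra.
Qed.

Lemma krasnoselskii_mann (T : E -> E) (z : nat -> E) p :
  firmly_nonexpansive T -> T p = p -> (forall k, z k.+1 = T (z k)) ->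
  exists2 zs, T zs = zs & z @ \oo --> zs.
Proof.
move=> fT Tp zS.
have fejer q : T q = q -> forall k,
    enorm (z k.+1 - q) ^+ 2 + enorm (z k - z k.+1) ^+ 2 <= enorm (z k - q) ^+ 2.
  by move=> Tq k; have := fT (z k) q; rewrite Tq subrr subr0 -zS.
have fejer_le q : T q = q -> forall k, enorm (z k.+1 - q) <= enorm (z k - q).
  by move=> Tq k; rewrite zS -{1}Tq; exact: firmly_nonexpansive_le.
have mono q : T q = q -> forall k j, (j <= k)%N -> enorm (z k - q) <= enorm (z j - q).
  move=> Tq k j; elim: k => [|k IH]; first by rewrite leqn0 => /eqP ->.
  rewrite leq_eqVlt => /orP[/eqP -> //|]; rewrite ltnS => /IH.
  exact/le_trans/fejer_le.
(* The squared step is at most the decrease of |z_k - p|^2, and these decreases tend to 0. *)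
have res e : 0 < e -> exists N, forall k, (N <= k)%N -> enorm (z k - z k.+1) < e.
  move=> e0; have e20 : 0 < e ^+ 2 by rewrite exprn_gt0.
  have [||N HN] := @nonincreasing_steps (fun k => enorm (z k - p) ^+ 2) _ _ _ e20.
  - by move=> k; exact: sqr_ge0.
  - by move=> k; rewrite ler_sqr ?nnegrE ?enorm_ge0 //; exact: fejer_le.
  exists N => k /HN h; rewrite -ltr_sqr ?nnegrE ?enorm_ge0 ?(ltW e0) //.
  by apply: le_lt_trans h; have := fejer p Tp k; lra.
have [zs zsP] : exists x, forall e N, 0 < e ->
    exists2 k, (N <= k)%N & enorm (z k - x) < e.
  apply: (@bolzano _ _ _ (enorm (z 0%N - p) + enorm p)) => k.
  rewrite -[z k](subrK p); apply: le_trans (enormD _ _) _.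
  by rewrite lerD2r mono.
have Tzs : T zs = zs.
  apply/eqP; rewrite -subr_eq0 -enorm_eq0 eq_le enorm_ge0 andbT.
  apply/ler_addgt0Pr => e e0; rewrite add0r.
  have e3 : 0 < e / 3 by rewrite divr_gt0.
  have [N HN] := res _ e3; have [k Nk kz] := zsP _ N e3.
  have h1 := HN k Nk.
  have h2 : enorm (T zs - T (z k)) <= enorm (z k - zs).
    by rewrite (enormBC (z k)); exact: firmly_nonexpansive_le.
  have h3 := enorm_triangle (T zs) (T (z k)) zs.
  have h4 := enorm_triangle (T (z k)) (z k) zs.
  move: h1; rewrite enormBC zS => h1.
  by apply: le_trans h3 _; apply: le_trans (lerD h2 h4) _; lra.
exists zs => //; apply/cvgn_enormP => e e0.
(* Since [zs] is itself a fixed point, the distance to it is nonincreasing: one close visit controls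
   all later iterates. *)
have [k _ kz] := zsP e 0%N e0; exists k => j kj.
by apply: le_lt_trans kz; exact: mono.
Qed.

End KrasnoselskiiMann.

(** With a = z - w, b = b1 - b2 and c = c1 - c2, the hypotheses add up to |b - c|^2 <= <a, b - c>,
    and the conclusion is |a - (b - c)|^2 + |b - c|^2 <= |a|^2. *)
Lemma dr_step_firm (K : realType) n (z w b1 b2 c1 c2 : 'cV[K]_n) :
  dot (b1 - b2) (b1 - b2) <= dot (b1 - b2) (z - w) ->
  dot (c1 - c2) (c1 - c2) <= dot (c1 - c2) (2 *: b1 - z - (2 *: b2 - w)) ->
  dot (z + c1 - b1 - (w + c2 - b2)) (z + c1 - b1 - (w + c2 - b2)) +
  dot (z - (z + c1 - b1) - (w - (w + c2 - b2))) (z - (z + c1 - b1) - (w - (w + c2 - b2)))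
  <= dot (z - w) (z - w).
Proof.
have -> : 2 *: b1 - z - (2 *: b2 - w) = 2 *: (b1 - b2) - (z - w).
  by apply/matrixP => i j; rewrite !mxE; ring.
have -> : z + c1 - b1 - (w + c2 - b2) = (z - w) + ((c1 - c2) - (b1 - b2)).
  by apply/matrixP => i j; rewrite !mxE; ring.
have -> : z - (z + c1 - b1) - (w - (w + c2 - b2)) = (b1 - b2) - (c1 - c2).
  by apply/matrixP => i j; rewrite !mxE; ring.
move: (z - w) (c1 - c2) (b1 - b2) => a c b.
rewrite !dotE (dotC b a) (dotC c a) (dotC c b).
by move: (dot a a) (dot a b) (dot a c) (dot b b) (dot b c) (dot c c) => *; lra.
Qed.

Section DouglasRachford.
Context {K : realType} {n : nat}.
Local Notation E := 'cV[K]_n.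
Context (R J : E -> \bar K) (gamma : K).
Hypotheses (pR : proper_fun R) (cR : convex_fun R) (lR : lower_semicontinuous R).
Hypotheses (pJ : proper_fun J) (cJ : convex_fun J) (lJ : lower_semicontinuous J).
Hypothesis g0 : 0 < gamma.

Local Notation PJ := (prox gamma J).
Local Notation PR := (prox gamma R).

Lemma F_DRE z : F_DR gamma R J z = z + PR (2 *: PJ z - z) - PJ z.
Proof.
rewrite /F_DR /reflector; apply/matrixP => i j; rewrite !mxE.
by field.
Qed.

Lemma F_DR_firm : firmly_nonexpansive (F_DR gamma R J).
Proof.
move=> z w; rewrite !F_DRE !sqr_enorm.
exact: dr_step_firm (prox_firm pJ cJ lJ g0 z w) (prox_firm pR cR lR g0 _ _).
Qed.

Lemma F_DR_fixpointE z : F_DR gamma R J z = z <-> PR (2 *: PJ z - z) = PJ z.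
Proof.
rewrite F_DRE -addrA; split => [/eqP|->]; last by rewrite subrr addr0.
by rewrite -subr_eq0 addrAC subrr add0r subr_eq0 => /eqP.
Qed.

(** At a fixed point both proxes take the same value x, with subgradient (z - x) / gamma for J and
    its opposite for R; these cancel when the two inequalities are added. *)
Lemma F_DR_fixpoint_argmin z : F_DR gamma R J z = z ->
  argmin (fun y => R y + J y)%E (PJ z).
Proof.
move=> /F_DR_fixpointE Tz y.
have sJ := prox_subdiff z pJ cJ lJ g0.
have sR := prox_subdiff (2 *: PJ z - z) pR cR lR g0; rewrite Tz in sR.
have [r Rx] := subdiff_fin pR sR; have [j Jx] := subdiff_fin pJ sJ.
move: (sR y) (sJ y); rewrite Rx Jx.
case: (R y) (pR.1 y) => [a| |] //; case: (J y) (pJ.1 y) => [b| |] // _ _.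
2,3,4: by rewrite ?addey ?addye ?leey.
rewrite -!EFinD !lee_fin !dotZl.
have -> : 2 *: PJ z - z - PJ z = - (z - PJ z).
  by apply/matrixP => i k; rewrite !mxE; ring.
by rewrite dotNl; move: (gamma^-1) (dot _ _) => ? ?; lra.
Qed.

Lemma F_DR_fixpoint_exists : ri (edom R) `&` ri (edom J) !=set0 ->
  argmin (fun y => R y + J y)%E !=set0 -> exists p, F_DR gamma R J p = p.
Proof.
move=> ri0 [x0 xmin]; have [g gR gJ] := subdiff_sum_at_min pR cR pJ cJ ri0 xmin.
(* This point minus x0 is gamma times the subgradient -g of J, and its reflection x0 + gamma g
   corresponds in the same way to the subgradient g of R. *)
exists (x0 - gamma *: g).
have PJx : PJ (x0 - gamma *: g) = x0.
  apply: prox_eq => //.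
  by rewrite addrAC subrr add0r scalerN scalerA mulVf ?gt_eqF // scale1r.
apply/F_DR_fixpointE; rewrite PJx; apply: prox_eq => //.
rewrite (_ : _ - x0 = gamma *: g); last first.
  by apply/matrixP => i j; rewrite !mxE; ring.
by rewrite scalerA mulVf ?gt_eqF // scale1r.
Qed.

Lemma douglas_rachford_cvg (u x z : nat -> E) :
  ri (edom R) `&` ri (edom J) !=set0 ->
  argmin (fun y => R y + J y)%E !=set0 ->
  (forall k, x k = PJ (z k)) ->
  (forall k, u k.+1 = PR (2 *: x k - z k)) ->
  (forall k, z k.+1 = z k + u k.+1 - x k) ->
  exists zs, [/\ z @ \oo --> zs, F_DR gamma R J zs = zs,
    x @ \oo --> PJ zs, u @ \oo --> PJ zs &
    argmin (fun y => R y + J y)%E (PJ zs)].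
Proof.
move=> ri0 am0 xE uE zE; have [p Tp] := F_DR_fixpoint_exists ri0 am0.
have zS k : z k.+1 = F_DR gamma R J (z k) by rewrite F_DRE zE uE xE.
have [zs Tzs zcvg] := krasnoselskii_mann F_DR_firm Tp zS.
have xcvg : x @ \oo --> PJ zs.
  apply/cvgn_enormP => e e0; have [N HN] := (cvgn_enormP _ _).1 zcvg e e0.
  exists N => k /HN; rewrite xE; apply: le_lt_trans.
  exact: prox_nonexpansive.
exists zs; split => //; last exact: F_DR_fixpoint_argmin.
(* [u 0] is arbitrary, so the limit is taken on the shifted sequence z_(k+1) - z_k + x_k. *)
have uS k : u k.+1 = z k.+1 - z k + x k.
  by rewrite zE; move: (z k) (x k) (u k.+1) => *; apply/matrixP => i j; rewrite !mxE; ring.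
rewrite -cvg_shiftS; under eq_fun do rewrite uS.
rewrite -[PJ zs]add0r -(subrr zs); apply: cvgD => //; apply: cvgB => //.
by rewrite cvg_shiftS.
Qed.

End DouglasRachford.

(** * Strict differentiability *)

Section DiffExpansion.
Context {K : realType} {V W : normedModType K}.

Lemma diff_expansion (f : V -> W) x : differentiable f x ->
  forall e, 0 < e -> exists2 d, 0 < d &
    forall h, `|h| < d -> `|f (x + h) - f x - 'd f x h| <= e * `|h|.
Proof.
move=> /diff_locally /eqaddoP fo e e0.
have /nbhs_ballP [d /= d0 dP] := fo e e0.
exists d => // h hd; have := dP h; rewrite -ball_normE /ball_ /= sub0r normrN => /(_ hd).
by rewrite !fctE /= (addrC h) opprD addrA.
Qed.

Lemma diff_of_expansion (f : V -> W) x (df : {linear V -> W}) : continuous df ->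
  (forall e, 0 < e -> exists2 d, 0 < d &
    forall h, `|h| < d -> `|f (x + h) - f x - df h| <= e * `|h|) ->
  differentiable f x /\ 'd f x = df :> (V -> W).
Proof.
move=> cdf H.
have fo : f \o shift x = cst (f x) + df +o_ 0 id.
  apply/eqaddoP => e e0; have [d d0 dP] := H e e0.
  apply/nbhs_ballP; exists d => // h; rewrite -ball_normE /ball_ /= sub0r normrN.
  by move=> /dP; rewrite !fctE /= (addrC h) opprD addrA.
have E := diff_unique cdf fo; split => //.
by apply/diff_locallyP; rewrite E.
Qed.

Lemma is_derive_line (f : V -> W) p v t : differentiable f (p + t *: v) ->
  is_derive t 1 (fun s => f (p + s *: v)) ('d f (p + t *: v) v).
Proof.
move=> df; have dv := @diff_derivable _ _ _ _ _ v df.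
have E : (fun h : K => h^-1 *: (((fun s => f (p + s *: v)) \o shift t) (h *: 1) -
    f (p + t *: v))) =
  (fun h => h^-1 *: ((f \o shift (p + t *: v)) (h *: v) - f (p + t *: v))).
  apply/funext => h /=; congr (_ *: (f _ - _)).
  by rewrite /shift /= scalerDl addrCA [h *: 1]mulr1.
split; first by rewrite /derivable E.
by rewrite /derive E -(deriveE v df).
Qed.

End DiffExpansion.

Section Gradient.
Context {K : realType} {n : nat}.
Local Notation E := 'cV[K]_n.
Implicit Types (x y v l : E) (f : E -> K).

Lemma cV_sum_delta v : v = \sum_i v i 0 *: delta_mx i 0.
Proof.
apply/matrixP => i j; rewrite (ord1 j) summxE (bigD1 i) //= !mxE !eqxx mulr1.
by rewrite big1 ?addr0 // => k ki; rewrite !mxE eq_sym (negPf ki) mulr0.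
Qed.

Definition grad f x : E := \col_i 'd f x (delta_mx i 0).

Lemma diff_gradE f x v : 'd f x v = dot (grad f x) v.
Proof.
rewrite {1}(cV_sum_delta v) linear_sum /=; apply: eq_bigr => i _.
by rewrite linearZ /= mxE mulrC.
Qed.

(** A named copy of [dot l] that can carry the bundled linear structure expected by
    [diff_of_expansion]. *)
Definition dotl l : E -> K^o := dot l.

Fact dotl_is_linear l : linear (dotl l).
Proof. by move=> t u v; rewrite /dotl dotDr dotZr. Qed.

HB.instance Definition _ l := GRing.isLinear.Build K E K^o *:%R (dotl l) (dotl_is_linear l).

Lemma dotl_continuous l : continuous (dotl l).
Proof.
move=> x B /nbhs_ballP [e /= e0 eB]; apply/nbhs_enormP.
have k0 : 0 < enorm l + 1 by rewrite ltr_wpDl ?enorm_ge0.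
exists (e / (enorm l + 1)); first by rewrite divr_gt0.
move=> y; rewrite ltr_pdivlMr // => yx.
apply: eB; rewrite -ball_normE /ball_ /= /dotl distrC -dotNr -dotDr.
apply: le_lt_trans (abs_dot_le _ _) _; apply: le_lt_trans yx.
by rewrite mulrC ler_wpM2l ?enorm_ge0 // lerDl.
Qed.

Lemma grad_expansion f x : differentiable f x ->
  forall e, 0 < e -> exists2 d, 0 < d &
    forall h, enorm h < d -> `|f (x + h) - f x - dot (grad f x) h| <= e * enorm h.
Proof.
move=> df e e0; have [d d0 H] := diff_expansion df e0.
exists d => // h hd; rewrite -diff_gradE.
apply: le_trans (H h _) _; first exact: le_lt_trans (norm_le_enorm _) hd.
by rewrite ler_pM2l // norm_le_enorm.
Qed.

Lemma grad_of_expansion f x l :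
  (forall e, 0 < e -> exists2 d, 0 < d &
    forall h, enorm h < d -> `|f (x + h) - f x - dot l h| <= e * enorm h) ->
  differentiable f x /\ forall v, 'd f x v = dot l v.
Proof.
move=> H; have [|df E] := @diff_of_expansion K E K^o f x (dotl l) (@dotl_continuous l).
  move=> e e0; have n0 : 0 < n.+1%:R :> K by rewrite ltr0n.
  have [|d d0 {}H] := H (e / n.+1%:R); first by rewrite divr_gt0.
  have nn (h : E) : enorm h <= n.+1%:R * `|h|.
    by apply: le_trans (enorm_le_norm _) _; rewrite ler_wpM2r // ler_nat.
  exists (d / n.+1%:R); first by rewrite divr_gt0.
  move=> h; rewrite ltr_pdivlMr // mulrC => hd.
  apply: le_trans (H h (le_lt_trans (nn h) hd)) _.
  by rewrite -mulrA ler_pM2l // mulrC ler_pdivrMr // mulrC.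
by split => // v; rewrite E.
Qed.

Lemma coord_differentiable i y :
  differentiable (fun z : E => z i 0) y /\
  forall v, 'd (fun z : E => z i 0) y v = v i 0.
Proof.
have [|dc cE] := @grad_of_expansion (fun z => z i 0) y (delta_mx i 0).
  move=> e e0; exists 1 => // h _; rewrite !mxE dotC dot_delta.
  by rewrite (addrC (y i 0)) addrK subrr normr0 mulr_ge0 ?enorm_ge0 // ltW.
by split => // v; rewrite cE dotC dot_delta.
Qed.

Lemma diff_coord (V : normedModType K) (F : V -> E) (p : V) i : differentiable F p ->
  differentiable (fun q => F q i 0) p /\
  forall w : V, 'd (fun q => F q i 0) p w = ('d F p w) i 0.
Proof.
move=> dF; have [dc cE] := coord_differentiable i (F p).
split; first exact: (@differentiable_comp _ _ _ _ F (fun y => y i 0)).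
by move=> v; rewrite (@diff_comp _ _ _ _ F (fun y => y i 0)) //= cE.
Qed.

Lemma vec_expansion (F : E -> E) x : differentiable F x ->
  forall e, 0 < e -> exists2 d, 0 < d &
    forall h, enorm h < d -> enorm (F (x + h) - F x - 'd F x h) <= e * enorm h.
Proof.
move=> dF e e0; have n0 : 0 < n.+1%:R :> K by rewrite ltr0n.
have [|d d0 H] := diff_expansion dF (_ : 0 < e / n.+1%:R); first by rewrite divr_gt0.
exists d => // h hd; have {}hd := le_lt_trans (norm_le_enorm _) hd.
apply: le_trans (enorm_le_norm _) _.
apply: (@le_trans _ _ (n.+1%:R * (e / n.+1%:R * `|h|))).
  by rewrite ler_pM ?ler_nat // H.
by rewrite mulrCA mulrA divfK ?gt_eqF // ler_pM2l // norm_le_enorm.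
Qed.

Lemma local_min_diff_eq0 f x v : differentiable f x ->
  (exists2 d, 0 < d & forall t, `|t| < d -> f x <= f (x + t *: v)) -> 'd f x v = 0.
Proof.
move=> df [d1 d10 fmin]; rewrite diff_gradE; set L := dot _ _.
apply/eqP; rewrite -normr_le0; apply/ler_addgt0Pr => e e0; rewrite add0r.
have v0 : 0 < enorm v + 1 by rewrite ltr_wpDl ?enorm_ge0.
have [|d2 d20 H] := grad_expansion df (_ : 0 < e / (enorm v + 1)).
  by rewrite divr_gt0.
pose t := Num.min (d1 / 2) (d2 / (enorm v + 1) / 2).
have t0 : 0 < t by rewrite lt_min !divr_gt0.
have td1 : t < d1.
  by apply: (@le_lt_trans _ _ (d1 / 2)); [rewrite ge_min lexx|lra].
have td2 : t * enorm v < d2.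
  have : t <= d2 / (enorm v + 1) / 2 by rewrite ge_min lexx orbT.
  rewrite ler_pdivlMr // ler_pdivlMr // => h; have := enorm_ge0 v; nra.
have key s : `|s| = t -> - (s * L) <= e * t.
  move=> st; have sd1 : `|s| < d1 by rewrite st.
  have := fmin s sd1; have := H (s *: v); rewrite enormZ st => /(_ td2).
  rewrite dotZr -/L ler_norml => /andP[_ h] h2.
  have h3 : e / (enorm v + 1) * (t * enorm v) <= e * t.
    have -> : e / (enorm v + 1) * (t * enorm v) = e * t * (enorm v / (enorm v + 1)).
      by ring.
    apply: ler_piMr; first by rewrite mulr_ge0 ?ltW.
    by rewrite ler_pdivrMr // mul1r lerDl.
  lra.
have := key t (gtr0_norm t0); have := key (- t); rewrite normrN => /(_ (gtr0_norm t0)).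
rewrite mulNr opprK => h1 h2.
by rewrite -(ler_pM2l t0); case: (ler0P L) => _; rewrite ?mulrN; lra.
Qed.

Lemma mean_value f (p v : E) :
  (forall t : K, 0 <= t <= 1 -> differentiable f (p + t *: v)) ->
  exists2 c, 0 < c < 1 & f (p + v) - f p = 'd f (p + c *: v) v.
Proof.
move=> df.
have dl (t : K) : 0 <= t <= 1 ->
    is_derive t 1 (fun s : K => f (p + s *: v)) ('d f (p + t *: v) v).
  by move=> t01; apply: is_derive_line; exact: df.
have [||c c01] := @MVT _ (fun s : K => f (p + s *: v)) (fun t : K => 'd f (p + t *: v) v) 0 1 ltr01.
- by move=> t; rewrite in_itv /= => /andP[t0 t1]; apply: dl; rewrite !ltW.
- apply: continuous_in_subspaceT => t /set_mem /=; rewrite in_itv /= => t01.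
  have [dt _] := dl t t01.
  exact/differentiable_continuous/derivable1_diffP.
rewrite scale1r scale0r addr0 subr0 mulr1; by exists c.
Qed.

End Gradient.

Section StrictDifferentiability.
Context {K : realType} {n : nat}.
Local Notation E := 'cV[K]_n.
Implicit Types (x y v l : E) (f : E -> K).

Lemma nbhs2_enormP x (P : E * E -> Prop) :
  (\forall p \near (x, x), P p) <->
  exists2 d, 0 < d & forall y y', enorm (y - x) < d -> enorm (y' - x) < d -> P (y, y').
Proof.
split.
  move=> [[A B] /= [/nbhs_enormP [a a0 aA] /nbhs_enormP [b b0 bB]] AB].
  exists (Num.min a b); first by rewrite lt_min a0.
  move=> y y'; rewrite !lt_min => /andP[ya _] /andP[_ yb]; apply: AB.
  by split; [exact: aA|exact: bB].
move=> [d d0 dP].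
exists ([set y | enorm (y - x) < d], [set y | enorm (y - x) < d]) => /=.
  by split; apply/nbhs_enormP; exists d.
by move=> [y y'] [/=]; exact: dP.
Qed.

(** Strict differentiability with gradient l: both points vary, unlike in the Frechet derivative at
    x. It is set up for scalar functions; vector maps are handled coordinate by coordinate. *)
Definition sdiff f x l := forall e, 0 < e ->
  \forall p \near (x, x), `|f p.1 - f p.2 - dot l (p.1 - p.2)| <= e * enorm (p.1 - p.2).

Definition lip_near f x := exists2 C, 0 <= C &
  \forall p \near (x, x), `|f p.1 - f p.2| <= C * enorm (p.1 - p.2).

Lemma sdiff_lip f x l : sdiff f x l -> lip_near f x.
Proof.
move=> sf; exists (1 + enorm l); first by rewrite addr_ge0 ?enorm_ge0.
apply: filterS (sf 1 ltr01) => p.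
have := abs_dot_le l (p.1 - p.2); move: (dot _ _) => c.
have := ler_normD (f p.1 - f p.2 - c) c; rewrite subrK => h1 h2 h3.
by apply: le_trans h1 _; rewrite mulrDl; apply: lerD.
Qed.

Lemma lip_near_cvg f x : lip_near f x -> forall e, 0 < e ->
  \forall p \near (x, x), `|f p.1 - f x| < e /\ `|f p.2 - f x| < e.
Proof.
move=> [C C0 /nbhs2_enormP [d d0 fd]] e e0; apply/nbhs2_enormP.
have C1 : 0 < C + 1 by rewrite ltr_wpDl.
exists (Num.min d (e / (C + 1))); first by rewrite lt_min d0 divr_gt0.
have x0 : enorm (x - x) < d by rewrite subrr enorm0.
suff H y : enorm (y - x) < Num.min d (e / (C + 1)) -> `|f y - f x| < e.
  by move=> y y' /H h1 /H h2.
rewrite lt_min ltr_pdivlMr // => /andP[yd ye]; apply: le_lt_trans (fd _ _ yd x0) _ => /=.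
by apply: le_lt_trans ye; rewrite mulrC ler_wpM2l ?enorm_ge0 // lerDl.
Qed.

Lemma sdiff_cst (c : K) x : sdiff (fun=> c) x 0.
Proof.
move=> e e0; apply/nbhs2_enormP; exists 1 => // y y' _ _ /=.
by rewrite dot0l !subrr normr0 mulr_ge0 ?enorm_ge0 // ltW.
Qed.

Lemma sdiff_coord i x : sdiff (fun y => y i 0) x (delta_mx i 0).
Proof.
move=> e e0; apply/nbhs2_enormP; exists 1 => // y y' _ _ /=.
by rewrite dotC dot_delta !mxE subrr normr0 mulr_ge0 ?enorm_ge0 // ltW.
Qed.

Lemma sdiffD f g x l m : sdiff f x l -> sdiff g x m ->
  sdiff (fun y => f y + g y) x (l + m).
Proof.
move=> sf sg e e0; have e2 : 0 < e / 2 by rewrite divr_gt0.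
apply: filterS2 (sf _ e2) (sg _ e2) => p /= h1 h2.
rewrite dotDl (_ : _ - _ = (f p.1 - f p.2 - dot l (p.1 - p.2)) +
  (g p.1 - g p.2 - dot m (p.1 - p.2))); last by ring.
apply: le_trans (ler_normD _ _) _; apply: le_trans (lerD h1 h2) _.
by rewrite -mulrDl -splitr.
Qed.

Lemma sdiffZ (c : K) f x l : sdiff f x l -> sdiff (fun y => c * f y) x (c *: l).
Proof.
move=> sf e e0; have c0 : 0 < `|c| + 1 by rewrite ltr_wpDl.
have e2 : 0 < e / (`|c| + 1) by rewrite divr_gt0.
apply: filterS (sf _ e2) => p /= h1.
rewrite dotZl -!mulrBr normrM.
apply: (@le_trans _ _ ((`|c| + 1) * (e / (`|c| + 1) * enorm (p.1 - p.2)))).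
  by apply: ler_pM => //; rewrite lerDl.
by rewrite mulrA mulrCA divff ?gt_eqF // mulr1.
Qed.

Lemma sdiff_sum (I : Type) (r : seq I) (F : I -> E -> K) (L : I -> E) x :
  (forall i, sdiff (F i) x (L i)) ->
  sdiff (fun y => \sum_(i <- r) F i y) x (\sum_(i <- r) L i).
Proof.
move=> sF; elim: r => [|i r IH].
  rewrite big_nil (_ : (fun y => _) = fun=> 0); first exact: sdiff_cst.
  by apply/funext => y; rewrite big_nil.
rewrite big_cons (_ : (fun y => _) = fun y => F i y + \sum_(j <- r) F j y).
  exact: sdiffD.
by apply/funext => y; rewrite big_cons.
Qed.

Lemma sdiffM f g x l m : sdiff f x l -> sdiff g x m ->
  sdiff (fun y => f y * g y) x (g x *: l + f x *: m).
Proof.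
move=> sf sg e e0.
have [Cf Cf0 lf] := sdiff_lip sf.
pose B := `|f x| + `|g x| + 1 + Cf + enorm m + 1.
have B0 : 0 < B.
  by rewrite /B ltr_wpDl // !addr_ge0 ?enorm_ge0.
(* The error of the product splits into five terms, bounded in [k1] to [k5] by [B * (e1 * enorm D)]
   each; [e1 <= 1] absorbs a product of two small factors. *)
pose e1 := Num.min 1 (e / (5 * B)).
have e10 : 0 < e1 by rewrite lt_min ltr01 divr_gt0 // mulr_gt0.
have e1e : e1 * (5 * B) <= e by rewrite -ler_pdivlMr ?mulr_gt0 // ge_min lexx orbT.
have e11 : e1 <= 1 by rewrite ge_min lexx.
apply: filterS (filterI (filterI (sf _ e10) (sg _ e10)) (filterI lf
  (filterI (lip_near_cvg (sdiff_lip sf) e10) (lip_near_cvg (sdiff_lip sg) e10)))).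
move=> [y y'] /= [[h1 h2] [h3 [[h4 h4'] [h5 h5']]]].
rewrite dotDl !dotZl; set D := y - y' in h1 h2 h3 *.
set a := f y - f y' - dot l D in h1; set b := g y - g y' - dot m D in h2.
have -> : f y * g y - f y' * g y' - (g x * dot l D + f x * dot m D) =
  g x * a + (f y - f y') * (g y - g x) + f x * b + (f y' - f x) * b +
  (f y' - f x) * dot m D by rewrite /a /b; ring.
have hm := abs_dot_le m D.
have d0 := enorm_ge0 D.
have k1 : `|g x * a| <= B * (e1 * enorm D).
  rewrite normrM; apply: ler_pM => //.
  rewrite /B; have := enorm_ge0 m; have := normr_ge0 (f x); lra.
have k2 : `|(f y - f y') * (g y - g x)| <= B * (e1 * enorm D).
  rewrite normrM; apply: (@le_trans _ _ (Cf * enorm D * e1)).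
    by apply: ler_pM => //; exact: ltW.
  rewrite -mulrA [enorm D * _]mulrC; apply: ler_wpM2r; first by rewrite mulr_ge0 // ltW.
  rewrite /B; have := enorm_ge0 m; have := normr_ge0 (f x); have := normr_ge0 (g x); lra.
have k3 : `|f x * b| <= B * (e1 * enorm D).
  rewrite normrM; apply: ler_pM => //.
  rewrite /B; have := enorm_ge0 m; have := normr_ge0 (g x); lra.
have k4 : `|(f y' - f x) * b| <= B * (e1 * enorm D).
  rewrite normrM; apply: ler_pM => //; apply: le_trans (ltW h4') _.
  rewrite /B; have := enorm_ge0 m; have := normr_ge0 (f x); have := normr_ge0 (g x); lra.
have k5 : `|(f y' - f x) * dot m D| <= B * (e1 * enorm D).
  rewrite normrM; apply: (@le_trans _ _ (e1 * (enorm m * enorm D))).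
    by apply: ler_pM => //; exact: ltW.
  rewrite mulrCA; apply: ler_wpM2r; first by rewrite mulr_ge0 // ltW.
  rewrite /B; have := normr_ge0 (f x); have := normr_ge0 (g x); lra.
have tri := fun p q : K => ler_normD p q.
apply: le_trans (tri _ _) _; apply: le_trans (lerD (tri _ _) k5) _.
apply: le_trans (lerD (lerD (tri _ _) k4) (lexx _)) _.
apply: le_trans (lerD (lerD (lerD (tri _ _) k3) (lexx _)) (lexx _)) _.
have k : e1 * (5 * B) * enorm D <= e * enorm D by rewrite ler_wpM2r.
move: k1 k2 k; move: (`|_|) (`|_|) (enorm D) => p q s k1 k2 k; nra.
Qed.

Lemma lip_near_vec (F : E -> E) x : (forall i, lip_near (fun y => F y i 0) x) ->
  exists2 C, 0 <= C &
    \forall p \near (x, x), enorm (F p.1 - F p.2) <= C * enorm (p.1 - p.2).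
Proof.
move=> lF; have /choice [C HC] : forall i, exists C, 0 <= C /\
    \forall p \near (x, x), `|F p.1 i 0 - F p.2 i 0| <= C * enorm (p.1 - p.2).
  by move=> i; have [C C0 HC] := lF i; exists C.
exists (\sum_i C i); first by apply: sumr_ge0 => i _; exact: (HC i).1.
apply: filterS (@filter_forall _ _ _ (nbhs (x, x)) _ (fun i => (HC i).2)) => p H.
apply: le_trans (enorm_le_sum _) _; rewrite mulr_suml.
by apply: ler_sum => i _; rewrite !mxE; exact: H.
Qed.

Lemma lip_near_vec_cvg (F : E -> E) x (C : K) : 0 <= C ->
  (\forall p \near (x, x), enorm (F p.1 - F p.2) <= C * enorm (p.1 - p.2)) ->
  (fun p : E * E => (F p.1, F p.2)) @ (x, x) --> (F x, F x).
Proof.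
move=> C0 /nbhs2_enormP [d d0 Fd] A /nbhs2_enormP [e e0 eA]; apply/nbhs2_enormP.
have C1 : 0 < C + 1 by rewrite ltr_wpDl.
exists (Num.min d (e / (C + 1))); first by rewrite lt_min d0 divr_gt0.
have x0 : enorm (x - x) < d by rewrite subrr enorm0.
suff H y : enorm (y - x) < Num.min d (e / (C + 1)) -> enorm (F y - F x) < e.
  by move=> y y' /H h1 /H h2; exact: eA.
rewrite lt_min ltr_pdivlMr // => /andP[yd ye]; apply: le_lt_trans (Fd _ _ yd x0) _ => /=.
by apply: le_lt_trans ye; rewrite mulrC ler_wpM2l ?enorm_ge0 // lerDl.
Qed.

(** F is Lipschitz near x, so the expansion of f at F x, taken along the pair of images, has an
    error controlled by |p.1 - p.2|. *)
Lemma sdiff_comp f (F : E -> E) x l (M : 'I_n -> E) :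
  (forall i, sdiff (fun y => F y i 0) x (M i)) -> sdiff f (F x) l ->
  sdiff (f \o F) x (\sum_i l i 0 *: M i).
Proof.
move=> sF sf e e0.
have [C C0 lF] := lip_near_vec (fun i => sdiff_lip (sF i)).
have e2 : 0 < e / 2 by rewrite divr_gt0.
have C1 : 0 < C + 1 by rewrite ltr_wpDl.
have cF := lip_near_vec_cvg C0 lF.
have h1 : \forall p \near (x, x), `|f (F p.1) - f (F p.2) - dot l (F p.1 - F p.2)| <=
    e / 2 / (C + 1) * enorm (F p.1 - F p.2) := cF _ (sf _ (divr_gt0 e2 C1)).
have h2 := sdiff_sum (index_enum 'I_n) (fun i => sdiffZ (l i 0) (sF i)) e2.
apply: filterS2 h1 (filterI h2 lF) => p /= h1 [h2' h3].
rewrite (_ : _ - _ = (f (F p.1) - f (F p.2) - dot l (F p.1 - F p.2)) +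
  (dot l (F p.1 - F p.2) - dot (\sum_i l i 0 *: M i) (p.1 - p.2))); last by ring.
apply: le_trans (ler_normD _ _) _.
rewrite [e]splitr mulrDl; apply: lerD; last first.
  rewrite [in X in X - _]/dot
    (_ : \sum_(i < n) _ = \sum_i l i 0 * F p.1 i 0 - \sum_i l i 0 * F p.2 i 0) //.
  by rewrite -sumrB; apply: eq_bigr => i _; rewrite !mxE mulrBr.
apply: le_trans h1 _.
apply: (@le_trans _ _ (e / 2 / (C + 1) * (C * enorm (p.1 - p.2)))).
  by rewrite ler_wpM2l // ltW // divr_gt0.
rewrite mulrA; apply: ler_wpM2r; first exact: enorm_ge0.
rewrite -mulrA; apply: ler_piMr; first exact: ltW.
by rewrite mulrC ler_pdivrMr // mul1r lerDl.
Qed.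

(** By the mean value theorem f y - f y' is the differential at a point of the segment applied to y
    - y', and continuity of the partial derivatives keeps it close to the differential at x. Each
    coordinate gets the share [e / n.+1]. *)
Lemma Ck1_sdiff (U : set E) f x : open U -> U x -> Ck 1 U f -> sdiff f x (grad f x).
Proof.
move=> oU Ux [df cf] e e0.
have n0 : 0 < n.+1%:R :> K by rewrite ltr0n.
have en : 0 < e / n.+1%:R by rewrite divr_gt0.
have H : \forall y \near x, U y /\ forall i : 'I_n,
    `|'d f y (delta_mx i 0) - 'd f x (delta_mx i 0)| < e / n.+1%:R.
  apply: filterI; first exact: open_nbhs_nbhs.
  apply: (@filter_forall _ _ _ (nbhs x) _) => i; have ci := cf (delta_mx i 0) x Ux.
  have := ci [set z : K | `|z - 'd f x (delta_mx i 0)| < e / n.+1%:R]; apply.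
  by apply/nbhs_ballP; exists (e / n.+1%:R) => // z; rewrite -ball_normE /ball_ /= distrC.
have /nbhs_enormP [d d0 dP] := H.
apply/nbhs2_enormP; exists d => // y y' yd yd' /=.
set v := y - y'.
have seg (t : K) : 0 <= t <= 1 -> enorm (y' + t *: v - x) < d.
  move=> /andP[t0 t1].
  have -> : y' + t *: v - x = t *: (y - x) + (1 - t) *: (y' - x).
    by rewrite /v; apply/matrixP => i j; rewrite !mxE; ring.
  apply: le_lt_trans (enormD _ _) _; rewrite !enormZ !ger0_norm ?subr_ge0 //.
  move: (enorm_ge0 (y - x)) (enorm_ge0 (y' - x)) yd yd'.
  move: (enorm (y - x)) (enorm (y' - x)) => a b a0 b0 ad bd.
  have : t * a + (1 - t) * b <= t * Num.max a b + (1 - t) * Num.max a b.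
    by apply: lerD; apply: ler_wpM2l; rewrite ?subr_ge0 // le_max lexx ?orbT.
  rewrite -[leRHS]mulrDl (addrCA t) subrr addr0 mul1r => /le_lt_trans; apply.
  by rewrite gt_max ad.
have [|c /andP[c0 c1]] := @mean_value _ _ f y' v.
  by move=> t /seg /dP [Uy _]; exact: df.
have -> : y' + v = y by rewrite /v addrC subrK.
move=> ->.
have c01 : 0 <= c <= 1 by rewrite !ltW.
have [_ Hc] := dP _ (seg c c01).
rewrite diff_gradE -dotNl -dotDl /dot.
apply: le_trans (ler_norm_sum _ _ _) _.
apply: (@le_trans _ _ (\sum_(i < n) e / n.+1%:R * enorm v)).
  apply: ler_sum => i _; rewrite normrM; apply: ler_pM => //.
    by rewrite !mxE ltW.
  exact: coord_le_enorm.
rewrite sumr_const card_ord -mulrnAl; apply: ler_wpM2r; first exact: enorm_ge0.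
rewrite -[leLHS]mulr_natr -mulrA; apply: ler_piMr; first exact: ltW.
by rewrite mulrC ler_pdivrMr // mul1r ler_nat.
Qed.

Lemma Ck1_coord (V : normedModType K) (U : set V) (F : V -> E) i : open U ->
  Ck 1 U F -> Ck 1 U (fun p => F p i 0).
Proof.
move=> oU [dF cF]; split.
  by move=> p Up; have [] := diff_coord i (dF p Up).
move=> w p Up.
have ci : {for p, continuous (fun q => ('d F q w) i 0)}.
  apply: (@continuous_comp _ _ _ (fun q => 'd F q w) (fun z : E => z i 0)).
    exact: cF.
  by have [dc _] := coord_differentiable i ('d F p w); exact: differentiable_continuous.
have E0 q : U q -> 'd (fun q => F q i 0) q w = ('d F q w) i 0.
  by move=> Uq; have [_ ->] := diff_coord i (dF q Uq).
rewrite /= /prop_for /continuous_at (E0 p Up); apply: cvg_trans ci; apply: near_eq_cvg.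
by apply: filterS (open_nbhs_nbhs (conj oU Up)) => q Uq; rewrite E0.
Qed.

Lemma Ck1_sdiff_vec (U : set E) (F : E -> E) x i : open U -> U x -> Ck 1 U F ->
  sdiff (fun y => F y i 0) x (grad (fun y => F y i 0) x).
Proof. by move=> oU Ux cF; apply: (Ck1_sdiff oU Ux); exact: Ck1_coord. Qed.

End StrictDifferentiability.

(** * Proximal maps of partly smooth functions *)

Section LocalLemmas.
Context {K : realType} {n : nat}.
Local Notation E := 'cV[K]_n.

Lemma continuous_enorm (f : E -> E) x : {for x, continuous f} ->
  forall e, 0 < e -> exists2 d, 0 < d & forall y, enorm (y - x) < d -> enorm (f y - f x) < e.
Proof.
move=> cf e e0; apply/nbhs_enormP.
by apply: (cf [set z | enorm (z - f x) < e]); apply/nbhs_enormP; exists e.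
Qed.

Lemma open_enorm (A : set E) x : open A -> A x ->
  exists2 d, 0 < d & forall y, enorm (y - x) < d -> A y.
Proof. by move=> oA Ax; apply/nbhs_enormP; apply: open_nbhs_nbhs. Qed.

Lemma subdiff_closed (F : E -> \bar K) x : (forall y, F y != -oo%E) ->
  closed (subdiff F x).
Proof.
move=> FNy; apply: enorm_closed => g Hg y.
case Fy: (F y) (FNy y) => [b| |] // _; last by rewrite leey.
case Fx: (F x) (FNy x) => [r| |] // _; last first.
  have [h /(_ y)] := Hg 1 ltr01; rewrite Fx Fy addye //.
rewrite -EFinD lee_fin; apply/ler_addgt0Pr => e e0.
have k0 : 0 < enorm (y - x) + 1 by rewrite ltr_wpDl ?enorm_ge0.
have [h /(_ y)] := Hg _ (divr_gt0 e0 k0); rewrite Fx Fy -EFinD lee_fin => h1.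
rewrite ltr_pdivlMr // => h2.
have := CauchySchwarz_dot (g - h) (y - x); rewrite enormBC dotDl dotNl.
have := enorm_ge0 (h - g); move: (enorm (h - g)) (enorm (y - x)) h2 => p q h2.
move: (dot g _) (dot h _) h1 => s t; nra.
Qed.

Lemma subdiff_convex (F : E -> \bar K) x g h t : (forall y, F y != -oo%E) ->
  0 <= t <= 1 -> subdiff F x g -> subdiff F x h -> subdiff F x (t *: g + (1 - t) *: h).
Proof.
move=> FNy /andP[t0 t1] gF hF y; move: (gF y) (hF y).
case: (F y) (FNy y) => [b| |] // _; last by move=> _ _; rewrite leey.
case: (F x) (FNy x) => [r| |] // _; rewrite ?addye // -!EFinD !lee_fin.
rewrite dotDl !dotZl => h1 h2.
have k1 : t * (r + dot g (y - x)) <= t * b by rewrite ler_wpM2l.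
have k2 : (1 - t) * (r + dot h (y - x)) <= (1 - t) * b by rewrite ler_wpM2l ?subr_ge0.
move: (dot g _) (dot h _) k1 k2 => p q; nra.
Qed.

(** The level hyperplane of e through v is an affine set containing S, hence it contains the affine
    hull. *)
Lemma orth_par (S : set E) v e : S v -> (forall p, S p -> dot e (p - v) = 0) ->
  orth (par S) e.
Proof.
move=> Sv Se _ [x [y [hx hy ->]]].
have aff z : affine_hull S z -> dot e (z - v) = 0.
  move=> /(_ [set p | dot e (p - v) = 0]); apply; split => // p q t /= hp hq.
  rewrite (_ : _ - v = (1 - t) *: (p - v) + t *: (q - v)).
    by rewrite dotDr !dotZr hp hq !mulr0 addr0.
  by apply/matrixP => i j; rewrite !mxE; ring.
have -> : x - y = (x - v) - (y - v) by rewrite opprB addrA subrK.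
by rewrite dotDr dotNr !aff // subrr.
Qed.

Lemma cluster_dot_le (e : nat -> E) es s :
  (forall d N, 0 < d -> exists2 k, (N <= k)%N & enorm (e k - es) < d) ->
  (forall d, 0 < d -> exists N, forall k, (N <= k)%N -> dot (e k) s <= d) ->
  dot es s <= 0.
Proof.
move=> ecl H; apply/ler_addgt0Pr => d d0; rewrite add0r.
have s0 : 0 < enorm s + 1 by rewrite ltr_wpDl ?enorm_ge0.
have d2 : 0 < d / 2 by rewrite divr_gt0.
have [N HN] := H _ d2; have [k Nk ek] := ecl _ N (divr_gt0 d2 s0).
have := HN k Nk; have := CauchySchwarz_dot (es - e k) s.
move: ek; rewrite ltr_pdivlMr // enormBC dotDl dotNl.
have := enorm_ge0 (es - e k); have := enorm_ge0 s.
move: (enorm s) (enorm (es - e k)) (dot es s) (dot (e k) s) => p q r t; nra.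
Qed.

Lemma dot_orthB (u v w : E) : dot u w = 0 -> dot u v = dot u (v - w).
Proof. by move=> uw; rewrite dotDr dotNr uw subr0. Qed.

Definition rows (L : 'I_n -> E) : 'M[K]_n := \matrix_(i, j) L i j 0.

Lemma rowsE L v i : (rows L *m v) i 0 = dot (L i) v.
Proof. by rewrite mxE; apply: eq_bigr => j _; rewrite mxE. Qed.

Lemma injective_unitmx (A : 'M[K]_n) : (forall v : E, A *m v = 0 -> v = 0) -> A \in unitmx.
Proof.
move=> Ainj; rewrite -unitmx_tr -row_free_unit -kermx_eq0; apply/eqP/row_matrixP => i.
rewrite row0; apply: trmx_inj; rewrite trmx0; apply: Ainj.
by apply: trmx_inj; rewrite trmx_mul trmxK trmx0 -row_mul mulmx_ker row0.
Qed.

End LocalLemmas.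

(** The clash is s a / 8 <= q <= s a / 16. In its use, s is the squared step along a curve, a the
    squared norm of its velocity, p the squared displacement and q the increase of the objective. *)
Lemma quadratic_growth_absurd (K : realFieldType) (s a p q : K) :
  s * (a / 2 ^+ 2) <= p -> 2^-1 * p <= q -> q <= a / 16 * s -> 0 < s -> 0 < a -> False.
Proof. by move=> h1 h2 h3 s0 a0; have : 0 < s * a by [rewrite mulr_gt0]; nra. Qed.

Section ProxOnManifold.
Context {K : realType} {n : nat}.
Local Notation E := 'cV[K]_n.
Context (F : E -> \bar K) (gamma : K) (M : set E) (xb wb : E).
Context (d : nat) (U W : set E) (psi phi : E -> E) (V : set E) (g : E -> K).
Hypothesis g0 : 0 < gamma.
Hypothesis pF : proper_fun F.
Hypotheses (Mxb : M xb) (Uxb : U xb) (diffeo : C2_diffeo U W psi phi).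

(** The coordinate subspace onto which the chart straightens M; it serves both for the coordinates
    of points of M and for those of tangent vectors. *)
Definition flat (a : E) := forall i : 'I_n, (d <= i)%N -> a i 0 = 0.

Hypothesis slice : forall y, U y -> (M y <-> flat (psi y)).
Hypotheses (oV : open V) (Vxb : V xb) (C2g : Ck 2 V g).
Hypothesis Fg : forall y, V y -> M y -> F y = (g y)%:E.

Let oU : open U. Proof. by case: diffeo. Qed.
Let oW : open W. Proof. by case: diffeo. Qed.
Let C2psi : Ck 2 U psi. Proof. by case: diffeo. Qed.
Let C2phi : Ck 2 W phi. Proof. by case: diffeo. Qed.
Let psiK y : U y -> W (psi y) /\ phi (psi y) = y. Proof. by case: diffeo => ? ? ? ? [H _] /H. Qed.
Let phiK y : W y -> U (phi y) /\ psi (phi y) = y. Proof. by case: diffeo => ? ? ? ? [_ H] /H. Qed.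
Let dpsi y : U y -> differentiable psi y. Proof. by case: C2psi => H _; exact: H. Qed.
Let dphi y : W y -> differentiable phi y. Proof. by case: C2phi => H _; exact: H. Qed.
Let dg y : V y -> differentiable g y. Proof. by case: C2g => H _; exact: H. Qed.
Local Notation yb := (psi xb).

Lemma chart_point y : W y -> flat y -> M (phi y).
Proof. by move=> Wy fy; have [Uy psiy] := phiK Wy; apply/slice => //; rewrite psiy. Qed.

Lemma diff_chartK y v : U y -> 'd phi (psi y) ('d psi y v) = v.
Proof.
move=> Uy; have [Wy _] := psiK Uy.
rewrite -[LHS]/(('d phi (psi y) \o 'd psi y) v) -(diff_comp (dpsi Uy) (dphi Wy)).
have [||_ E0] := @diff_of_expansion K E E (phi \o psi) y idfun; last by rewrite E0.
  by move=> ? ?.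
move=> e e0; have [r r0 rU] := open_enorm oU Uy.
have n0 : 0 < n.+1%:R :> K by rewrite ltr0n.
exists (r / n.+1%:R); first by rewrite divr_gt0.
move=> h; rewrite ltr_pdivlMr // => hr.
have Uh : U (y + h).
  apply: rU; rewrite addrAC subrr add0r; apply: le_lt_trans (enorm_le_norm _) _.
  by apply: le_lt_trans hr; rewrite mulrC ler_wpM2l // ler_nat.
rewrite /= (psiK Uh).2 (psiK Uy).2 (addrC y) addrK subrr normr0.
by rewrite mulr_ge0 // ltW.
Qed.

(** For a curve c in M, the coordinates of index at least d of psi o c vanish identically near 0,
    and so do their derivatives. *)
Lemma tangent_flat v : tangent_space M xb v -> flat ('d psi xb v) /\ 'd phi yb ('d psi xb v) = v.
Proof.
move=> [c [e [e0 [dc _] cM c0 cv]]]; split; last exact: diff_chartK.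
have I0 : `]-e, e[%classic (0 : K) by rewrite /= in_itv /= oppr_lt0 e0.
have dc0 := dc _ I0.
have dpc : differentiable psi (c 0) by rewrite c0; exact: dpsi.
move=> i di.
have -> : ('d psi xb v) i 0 = 'd (fun t => (psi \o c) t i 0) 0 1.
  have [_ ->] := @diff_coord _ _ _ (psi \o c) 0 i (differentiable_comp dc0 dpc).
  by rewrite (diff_comp dc0 dpc) /= cv c0.
have [||_ ->] := @diff_of_expansion K K K^o (fun t => (psi \o c) t i 0) 0 \0; last by [].
  exact: cst_continuous.
move=> eps eps0.
have cc0 : {for 0, continuous c} by exact: differentiable_continuous.
have : \forall t \near (0 : K), U (c t) /\ `]-e, e[%classic t.
  apply: filterI; last by apply: near_in_itvoo; rewrite in_itv /= oppr_lt0 e0.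
  by apply: cc0; rewrite c0; exact: open_nbhs_nbhs.
move=> /nbhs_ballP [r /= r0 Hr]; exists r => // h hr.
have z0 t : U (c t) -> `]-e, e[%classic t -> psi (c t) i 0 = 0.
  move=> Uc Ic; have Mc : M (c t) by apply: cM; exists t.
  exact: ((slice Uc).1 Mc).
have [Uh Ih] : U (c h) /\ `]-e, e[%classic h.
  by apply: Hr; rewrite -ball_normE /ball_ /= sub0r normrN.
rewrite add0r /= z0 // z0 //; last by rewrite c0.
by rewrite !subr0 normr0 mulr_ge0 // ltW.
Qed.

(** The objective of [prox] with F replaced by its C2 representative g: the two agree on M near xb,
    and this one can be differentiated. *)
Definition prox_objective (w : E) (x : E) : K := gamma * g x + 2^-1 * enorm (x - w) ^+ 2.

Lemma diff_prox_objective w x : V x ->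
  differentiable (prox_objective w) x /\
  forall v, 'd (prox_objective w) x v = dot (gamma *: grad g x + (x - w)) v.
Proof.
move=> Vx; apply: grad_of_expansion => e e0.
have e2 : 0 < e / 2 / gamma by rewrite !divr_gt0.
have [r r0 H] := grad_expansion (dg Vx) e2.
exists (Num.min r e); first by rewrite lt_min r0.
move=> h; rewrite lt_min => /andP[hr he].
rewrite /prox_objective !sqr_enorm (_ : x + h - w = (x - w) + h); last by rewrite addrAC.
rewrite (_ : _ - dot _ h =
    gamma * (g (x + h) - g x - dot (grad g x) h) + 2^-1 * dot h h); last first.
  move: (x - w) (grad g x) => p q; rewrite !dotE (dotC h p).
  by move: (dot p p) (dot p h) (dot h h) (dot q h) => *; field.
apply: le_trans (ler_normD _ _) _.
rewrite normrM gtr0_norm // -sqr_enorm (ger0_norm (mulr_ge0 _ (sqr_ge0 _))) //.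
have := H h hr; rewrite -(ler_pM2l g0) mulrA mulrCA mulfV ?gt_eqF // mulr1.
have := enorm_ge0 h; move: (enorm h) he (_ * `|_|) => a ha p; nra.
Qed.

Lemma diff_prox_objective_chart w y a : W y -> V (phi y) ->
  differentiable (prox_objective w \o phi) y /\
  'd (prox_objective w \o phi) y a = dot (gamma *: grad g (phi y) + (phi y - w)) ('d phi y a).
Proof.
move=> Wy Vy; have [dG GE] := diff_prox_objective w Vy.
split; first exact: differentiable_comp (dphi Wy) dG.
by rewrite (diff_comp (dphi Wy) dG) /= GE.
Qed.

Local Notation vec w x := (gamma^-1 *: (w - x)).

(* Minimise gamma g + |. - w|^2 / 2 over a compact piece of M; quadratic growth at
   xb keeps the minimiser off its boundary. *)
Lemma critical_point_on_manifold : subdiff F xb (vec wb xb) ->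
  exists2 dl, 0 < dl & forall w, enorm (w - wb) < dl ->
  exists y, [/\ W y, flat y, V (phi y), enorm (phi y - xb) <= 2 * enorm (w - wb) &
    forall a, flat a -> dot (gamma *: grad g (phi y) + (phi y - w)) ('d phi y a) = 0].
Proof.
move=> sub0.
have [Wyb phiyb] := psiK Uxb.
have cphi : {for yb, continuous phi} by exact/differentiable_continuous/dphi.
have cpsi : {for xb, continuous psi} by exact/differentiable_continuous/dpsi.
have [r1 r10 Wr1] := open_enorm oW Wyb.
have [s s0 Vs] := open_enorm oV Vxb.
have [r2 r20 phir2] := continuous_enorm cphi s0; rewrite phiyb in phir2.
pose r := Num.min r1 r2 / 2.
have r0 : 0 < r by rewrite divr_gt0 // lt_min r10.
have rr y : enorm (y - yb) <= r -> W y /\ V (phi y).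
  move=> yr; have : enorm (y - yb) < Num.min r1 r2.
    by apply: le_lt_trans yr _; rewrite /r; have : 0 < Num.min r1 r2 by [rewrite lt_min r10]; lra.
  by rewrite lt_min => /andP[y1 y2]; split; [exact: Wr1|exact/Vs/phir2].
have [eta eta0 psieta] := continuous_enorm cpsi r0.
(* Half of [eta], because the minimiser will only be known to lie within 2 |w - wb| of xb. *)
exists (eta / 2); first by rewrite divr_gt0.
move=> w wd.
have fyb : flat yb by exact/slice.
pose A := [set y | enorm (y - yb) <= r] `&` [set y | flat y].
have cA : compact A.
  apply: subclosed_compact (compact_cball yb r) _; last by move=> y [].
  apply: closedI; first exact: closed_cball.
  apply: enorm_closed => y yA i di; apply/eqP; rewrite -normr_le0.
  apply/ler_addgt0Pr => e e0; rewrite add0r; have [z fz zy] := yA e e0.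
  apply: le_trans (ltW zy); rewrite enormBC; apply: le_trans (coord_le_enorm _ i).
  by rewrite !mxE fz // subr0.
have A0 : A yb by split => //=; rewrite subrr enorm0 ltW.
have contA : {within A, continuous (prox_objective w \o phi)}.
  apply: continuous_in_subspaceT => y /set_mem [/rr [Wy Vy] _].
  by apply: differentiable_continuous; have [] := diff_prox_objective_chart w 0 Wy Vy.
have [y /set_mem [/= yr fy] ymin] := compact_EVT_min (ex_intro _ _ A0) cA contA.
have [Wy Vy] := rr y yr.
(* Minimality against [yb] for w, combined with growth at xb for wb, gives |phi y - xb|^2 <= 2 <w -
   wb, phi y - xb>. *)
have dist : enorm (phi y - xb) <= 2 * enorm (w - wb).
  have := ymin yb (mem_set A0); rewrite /= /prox_objective phiyb.
  have := subdiff_growth g0 pF sub0 (phi y).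
  rewrite !Fg //; last exact: chart_point.
  rewrite -!EFinM -!EFinD lee_fin !sqr_enorm => h1 h2.
  have : dot (phi y - xb) (phi y - xb) <= 2 * dot (w - wb) (phi y - xb).
    move: h1 h2.
    rewrite (_ : phi y - wb = (phi y - xb) + (xb - wb)); last by rewrite addrA subrK.
    rewrite (_ : phi y - w = (phi y - xb) + ((xb - wb) - (w - wb))); last first.
      by rewrite opprB !addrA !subrK.
    rewrite (_ : xb - w = (xb - wb) - (w - wb)); last by rewrite opprB addrA subrK.
    move: (phi y - xb) (xb - wb) (w - wb) => p q t.
    rewrite !dotE (dotC q p) (dotC t p) (dotC t q).
    by move: (dot _ _) (dot _ _) (dot _ _) (dot _ _) (dot _ _) (dot _ _) => *; lra.
  have [->|] := eqVneq (phi y - xb) 0.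
    by rewrite enorm0 mulr_ge0 // enorm_ge0.
  rewrite -enorm_gt0 => p0; rewrite -sqr_enorm => h.
  rewrite -(ler_pM2r p0) -expr2 -mulrA; apply: le_trans h _.
  by rewrite ler_pM2l //; exact: CauchySchwarz_dot.
exists y; split => // a fa.
have [dGy <-] := diff_prox_objective_chart w a Wy Vy.
apply: local_min_diff_eq0 => //.
(* By continuity of psi at xb, y is interior to the ball and can be moved a little in every flat
   direction. *)
have yr' : enorm (y - yb) < r.
  have [_ <-] := phiK Wy; apply: psieta; apply: le_lt_trans dist _; lra.
have a1 : 0 < enorm a + 1 by rewrite ltr_wpDl ?enorm_ge0.
exists ((r - enorm (y - yb)) / (enorm a + 1)); first by rewrite divr_gt0 ?subr_gt0.
move=> t; rewrite ltr_pdivlMr // => ht; apply: ymin; apply: mem_set; split => /=; last first.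
  by move=> i di; rewrite !mxE fy // fa // mulr0 addr0.
rewrite addrAC; apply: le_trans (enormD _ _) _; rewrite enormZ.
have := normr_ge0 t; move: (`|t|) (enorm a) (enorm _) ht => p q u; nra.
Qed.

(** As q is a subgradient, g - <q, .> restricted to M has a local minimum at phi y, so q and grad g
    have the same tangential component there. *)
Lemma subdiff_chart y q a : W y -> flat y -> V (phi y) -> subdiff F (phi y) q ->
  flat a -> dot (grad g (phi y) - q) ('d phi y a) = 0.
Proof.
move=> Wy fy Vy sq fa.
have dl : differentiable (fun x => g x - dot q x) (phi y) /\
    forall v, 'd (fun x => g x - dot q x) (phi y) v = dot (grad g (phi y) - q) v.
  apply: grad_of_expansion => e e0; have [r r0 H] := grad_expansion (dg Vy) e0.
  exists r => // h hr; have := H h hr; congr (`|_| <= _).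
  by rewrite dotDr dotDl dotNl; ring.
have [dd dE] := dl.
rewrite -dE -[LHS]/((_ \o 'd phi y) a) -(diff_comp (dphi Wy) dd).
apply: local_min_diff_eq0; first exact: differentiable_comp (dphi Wy) dd.
have : nbhs y (W `&` phi @^-1` V).
  apply: filterI; first exact: open_nbhs_nbhs.
  by apply: (differentiable_continuous (dphi Wy)); exact: open_nbhs_nbhs.
move=> /nbhs_enormP [r r0 Hr].
have a1 : 0 < enorm a + 1 by rewrite ltr_wpDl ?enorm_ge0.
exists (r / (enorm a + 1)); first by rewrite divr_gt0.
move=> t; rewrite ltr_pdivlMr // => ht.
have [Wt Vt] : (W `&` phi @^-1` V) (y + t *: a).
  apply: Hr; rewrite addrAC subrr add0r enormZ; apply: le_lt_trans ht.
  by rewrite ler_wpM2l // lerDl.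
have ft : flat (y + t *: a) by move=> i di; rewrite !mxE fy // fa // mulr0 addr0.
have := sq (phi (y + t *: a)).
rewrite (Fg Vy (chart_point Wy fy)) (Fg Vt (chart_point Wt ft)) -EFinD lee_fin.
by rewrite dotDr dotNr /=; lra.
Qed.

(** * Identification: near wb, the prox takes its values in M *)

Hypothesis sharp : tangent_space M xb = orth (par (subdiff F xb)).
Hypothesis cont : setvalued_continuous (subdiff F) M xb.
Hypothesis nondeg : ri (subdiff F xb) (vec wb xb).

Lemma prox_identification :
  exists2 dl, 0 < dl & forall w, enorm (w - wb) < dl ->
    [/\ U (prox gamma F w), V (prox gamma F w), M (prox gamma F w) &
    forall a, flat a -> dot (gamma *: grad g (prox gamma F w) + (prox gamma F w - w))
       ('d phi (psi (prox gamma F w)) a) = 0].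
Proof.
have [dl0 dl00 Hcrit] := critical_point_on_manifold nondeg.1.
pose crit w y := [/\ W y, flat y, V (phi y), enorm (phi y - xb) <= 2 * enorm (w - wb) &
    forall a, flat a -> dot (gamma *: grad g (phi y) + (phi y - w)) ('d phi y a) = 0].
(* Once (w - phi y) / gamma is a subgradient at the critical point phi y, [prox_eq] identifies phi y
   with the prox. *)
suff [dl dl_gt0 Hdl] : exists2 dl, 0 < dl & forall w y, enorm (w - wb) < dl -> crit w y ->
    subdiff F (phi y) (vec w (phi y)).
  exists (Num.min dl dl0); first by rewrite lt_min dl_gt0.
  move=> w; rewrite lt_min => /andP[wdl /Hcrit [y cy]].
  rewrite (prox_eq g0 pF (Hdl _ _ wdl cy)).
  have [Wy fy Vy _ foc] := cy; have [Uy psiy] := phiK Wy.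
  by rewrite psiy; split => //; exact: chart_point.
apply: contrapT => Hno.
have innerS p : subdiff F xb p -> forall e, 0 < e -> exists2 dl, 0 < dl &
    forall x, enorm (x - xb) < dl -> M x -> exists2 q, subdiff F x q & enorm (q - p) < e.
  move=> Sp e e0; apply/nbhs_enormP.
  have nB : nbhs p [set q | enorm (q - p) < e] by apply/nbhs_enormP; exists e.
  apply: filterS (cont.2 p Sp _ nB) => x H Mx.
  by have [q [Sq qe]] := H Mx; exists q.
(* On M within [dl1] of xb the subdifferential is nonempty, as the projection below requires. *)
have [dl1 dl10 S1] := innerS _ nondeg.1 1 ltr01.
have bad (k : nat) : exists wye : E * E * E,
    [/\ enorm (wye.1.1 - wb) < k.+1%:R^-1, crit wye.1.1 wye.1.2, enorm wye.2 = 1,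
     forall a, flat a -> dot wye.2 ('d phi (wye.1.2) a) = 0 &
     forall p, subdiff F (phi wye.1.2) p -> dot wye.2 (p - vec wye.1.1 (phi wye.1.2)) <= 0].
  apply: contrapT => nbad; apply: Hno.
  exists (Num.min k.+1%:R^-1 (dl1 / 2)).
    by rewrite lt_min invr_gt0 ltr0n divr_gt0.
  move=> w y; rewrite lt_min => /andP[wk wdl] cy; apply: contrapT => nS.
  apply: nbad; have [Wy fy Vy dist foc] := cy.
  have My := chart_point Wy fy.
  have [|p0 Sp0 _] := S1 (phi y) _ My; first by apply: le_lt_trans dist _; lra.
  have [|||q Sq qproj] := @projection_convex K n (subdiff F (phi y)) (vec w (phi y)).
  - exact: subdiff_closed pF.1.
  - by exists p0.
  - by move=> u v t t01; exact: subdiff_convex pF.1 t01.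
  set v := vec w (phi y) in nS qproj *.
  have vq : v - q != 0.
    by apply/eqP => /eqP; rewrite subr_eq0 => /eqP vq; apply: nS; rewrite vq.
  have vq0 : 0 < enorm (v - q) by rewrite enorm_gt0.
  exists ((w, y), (enorm (v - q))^-1 *: (v - q)) => /=; split => //.
  - by rewrite enormZ ger0_norm ?invr_ge0 ?enorm_ge0 // mulVf // gt_eqF.
  - move=> a fa; rewrite dotZl.
    have h1 := subdiff_chart Wy fy Vy Sq fa.
    have h2 := foc a fa.
    suff -> : dot (v - q) ('d phi y a) = 0 by rewrite mulr0.
    (* Both v and q have the tangential component of grad g, v because y is critical and q by
       [subdiff_chart]; their difference is therefore normal to M. *)
    have -> : v - q = (grad g (phi y) - q) - gamma^-1 *: (gamma *: grad g (phi y) + (phi y - w)).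
      rewrite scalerDr scalerA mulVf ?gt_eqF // scale1r /v.
      rewrite opprD [in RHS]addrAC [X in _ = X - q]addrA subrr add0r.
      by rewrite -scalerN opprB.
    by rewrite dotDl dotNl dotZl h1 h2 mulr0 subr0.
  - move=> p Sp; rewrite dotZl pmulr_rle0 ?invr_gt0 //.
    have := qproj p Sp; rewrite (_ : p - q = (p - v) + (v - q)); last by rewrite addrA subrK.
    rewrite dotDr; have := dot_ge0 (v - q); lra.
have [wye Hwye] := choice bad.
pose e k := (wye k).2; pose y k := (wye k).1.2; pose w k := (wye k).1.1.
have {}Hwye k : [/\ enorm (w k - wb) < k.+1%:R^-1, crit (w k) (y k), enorm (e k) = 1,
     forall a, flat a -> dot (e k) ('d phi (y k) a) = 0 &
     forall p, subdiff F (phi (y k)) p -> dot (e k) (p - vec (w k) (phi (y k))) <= 0].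
  exact: Hwye.
clearbody e y w; clear wye.
have [es ecl] : exists x, forall d N, 0 < d -> exists2 k, (N <= k)%N & enorm (e k - x) < d.
  by apply: (@bolzano _ _ _ 1) => k; have [_ _ ->] := Hwye k.
have e1 k : enorm (e k) = 1 by have [_ _ ->] := Hwye k.
have wcvg t : 0 < t -> exists N, forall k, (N <= k)%N -> enorm (w k - wb) < t.
  move=> t0; have [N HN] : exists N : nat, (N.+1%:R^-1 : K) < t.
    exists (Num.truncn t^-1); rewrite invf_plt ?posrE ?ltr0n //.
    by apply: truncnS_gt.
  exists N => k Nk; apply: le_lt_trans HN; have [/ltW h _ _ _ _] := Hwye k.
  by apply: le_trans h _; rewrite lef_pV2 ?posrE ?ltr0n // ler_nat.
have xcvg t : 0 < t -> exists N, forall k, (N <= k)%N -> enorm (phi (y k) - xb) < t.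
  move=> t0; have [N HN] := wcvg _ (divr_gt0 t0 (ltr0n K 2)).
  exists N => k /HN; have [_ [_ _ _ h _] _ _ _] := Hwye k.
  by rewrite ltr_pdivlMr // mulrC; exact: le_lt_trans.
have es1 : enorm es = 1.
  apply/eqP; rewrite -subr_eq0 -normr_le0; apply/ler_addgt0Pr => t t0; rewrite add0r.
  have [k _ ek] := ecl t 0%N t0; apply: le_trans (ltW ek).
  by rewrite -(e1 k) enormBC enorm_dist.
(* Normality passes to the cluster point because the differential of phi in a fixed direction is
   continuous and y k tends to yb. *)
have eTan a : flat a -> dot es ('d phi yb a) = 0.
  move=> fa.
  have [Wyb _] := psiK Uxb.
  have cdphi : {for yb, continuous (fun z => 'd phi z a)}.
    by apply: differentiable_continuous; exact: (C2phi.2 a).1.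
  have cpsi : {for xb, continuous psi} by exact/differentiable_continuous/dpsi.
  have dcvg t : 0 < t -> exists N, forall k, (N <= k)%N ->
      enorm ('d phi (y k) a - 'd phi yb a) < t.
    move=> t0; have [r r0 Hr] := continuous_enorm cdphi t0.
    have [s s0 Hs] := continuous_enorm cpsi r0.
    have [N HN] := xcvg s s0; exists N => k /HN /Hs.
    have [_ [Wy _ _ _ _] _ _ _] := Hwye k.
    by rewrite (phiK Wy).2; exact: Hr.
  have bnd t : 0 < t -> exists N, forall k, (N <= k)%N -> `|dot (e k) ('d phi yb a)| <= t.
    move=> t0; have [N HN] := dcvg t t0; exists N => k Nk.
    have [_ _ _ /(_ a fa) h _] := Hwye k.
    rewrite (dot_orthB _ h); apply: le_trans (abs_dot_le _ _) _.
    by rewrite e1 mul1r enormBC ltW // HN.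
  apply/eqP; rewrite eq_le; apply/andP; split.
    apply: (cluster_dot_le ecl) => t /bnd [N HN]; exists N => k /HN.
    by apply: le_trans; exact: ler_norm.
  rewrite -oppr_le0 -dotNr; apply: (cluster_dot_le ecl) => t /bnd [N HN]; exists N => k /HN.
  by rewrite dotNr; apply: le_trans; rewrite -normrN; exact: ler_norm.
(* Inner continuity approximates p by subgradients q at phi (y k). Half of t pays for p - q, and
   half for the displacement of [vec], shared between w and phi y. *)
have eS p : subdiff F xb p -> dot es (p - vec wb xb) <= 0.
  move=> Sp; apply: (cluster_dot_le ecl) => t t0.
  have t2 : 0 < t / 2 by rewrite divr_gt0.
  have [r r0 Hr] := innerS p Sp _ t2.
  have [N1 HN1] := xcvg r r0.
  have t4 : 0 < gamma * (t / 2) / 2 by rewrite divr_gt0 // mulr_gt0.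
  have [N2 HN2] := xcvg _ t4; have [N3 HN3] := wcvg _ t4.
  exists (maxn N1 (maxn N2 N3)) => k; rewrite !geq_max => /and3P[k1 k2 k3].
  have [_ [Wy fy _ _ _] _ _ eSk] := Hwye k.
  have [q Sq qp] := Hr _ (HN1 k k1) (chart_point Wy fy).
  have h := eSk q Sq.
  have -> : p - vec wb xb =
    (p - q) + (q - vec (w k) (phi (y k))) + (vec (w k) (phi (y k)) - vec wb xb).
    by rewrite !addrA !subrK.
  rewrite !dotDr.
  have b1 := CauchySchwarz_dot (e k) (p - q); rewrite e1 mul1r enormBC in b1.
  have b2 := CauchySchwarz_dot (e k) (vec (w k) (phi (y k)) - vec wb xb).
  have b3 : enorm (vec (w k) (phi (y k)) - vec wb xb) <= t / 2.
    rewrite -scalerBr enormZ gtr0_norm ?invr_gt0 // ler_pdivrMl //.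
    rewrite (_ : _ - (wb - xb) = (w k - wb) - (phi (y k) - xb)); last first.
      by move: (phi _) (w k) => p' q'; apply/matrixP => i j; rewrite !mxE; ring.
    by apply: le_trans (enormB _ _) _; have := HN2 k k2; have := HN3 k k3; lra.
  rewrite e1 mul1r in b2.
  rewrite dotDr in h; rewrite dotDr in b2.
  move: b1 b2 h; rewrite ?dotDr; lra.
have : tangent_space M xb es.
  rewrite sharp; apply: (orth_par nondeg.1) => p Sp.
  apply/eqP; rewrite eq_le eS //=.
  (* Prolonging the segment from p beyond the relative interior point reverses the inequality of
     [eS], so <es, .> is constant on the subdifferential. *)
  have [eta eta0 /eS] := ri_extend nondeg Sp.
  rewrite addrAC subrr add0r dotZr pmulr_rle0 // -opprB dotNr.
  by rewrite oppr_le0.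
move=> /tangent_flat [fl esE].
have := eTan _ fl; rewrite esE -sqr_enorm es1 expr1n => /eqP.
by rewrite oner_eq0.
Qed.

(** * Strict differentiability of the prox from the optimality system *)

Hypotheses (cF : convex_fun F) (lF : lower_semicontinuous F).

Local Notation P := (prox gamma F).
Let Wyb : W yb. Proof. exact: (psiK Uxb).1. Qed.
Let phiyb : phi yb = xb. Proof. exact: (psiK Uxb).2. Qed.
Let fyb : flat yb. Proof. exact/slice. Qed.
Let Pwb : P wb = xb. Proof. exact: prox_eq g0 pF nondeg.1. Qed.

(** Evaluated at psi x, so that the tangent vectors of the chart become functions of x on a
    neighbourhood of xb in R^n and not only on M. *)
Definition chart_tangent (i : 'I_n) (x : E) : E := 'd phi (psi x) (delta_mx i 0).

Lemma Ck1_psi : Ck 1 U psi.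
Proof.
split; first exact: C2psi.1.
by move=> v y Uy; apply: differentiable_continuous; exact: (C2psi.2 v).1.
Qed.

Lemma chart_tangent_sdiff i j : exists l, sdiff (fun x => chart_tangent i x j 0) xb l.
Proof.
have sphi : sdiff (fun y => ('d phi y (delta_mx i 0)) j 0) yb _ :=
  Ck1_sdiff_vec j oW Wyb (C2phi.2 (delta_mx i 0)).
have spsi k := Ck1_sdiff_vec k oU Uxb Ck1_psi.
by have sc := sdiff_comp spsi sphi; eexists; exact: sc.
Qed.

(** The i-th tangency condition with w frozen at wb: a function of x alone, strictly differentiable
    at xb. What depends on w is on the other side of [prox_residual]. *)
Definition residual (i : 'I_n) (x : E) : K :=
  dot (gamma *: grad g x + (x - wb)) (chart_tangent i x).

Lemma residual_sdiff i : exists l, sdiff (residual i) xb l.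
Proof.
have sj j : exists l,
    sdiff (fun x => (gamma * grad g x j 0 + (x j 0 - wb j 0)) * chart_tangent i x j 0) xb l.
  have [l sl] := chart_tangent_sdiff i j.
  have sg : sdiff (fun x => grad g x j 0) xb (grad (fun x => 'd g x (delta_mx j 0)) xb).
    rewrite (_ : (fun x => _) = fun x => 'd g x (delta_mx j 0)).
      exact: Ck1_sdiff oV Vxb (C2g.2 _).
    by apply/funext => x; rewrite mxE.
  have s1 := sdiffD (sdiffZ gamma sg) (sdiffD (sdiff_coord j xb) (sdiff_cst (- wb j 0) xb)).
  by have s2 := sdiffM s1 sl; eexists; exact: s2.
have [L HL] := choice sj.
exists (\sum_j L j); rewrite (_ : residual i = fun x => \sum_j
    (gamma * grad g x j 0 + (x j 0 - wb j 0)) * chart_tangent i x j 0); first exact: sdiff_sum.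
by apply/funext => x; rewrite /residual /dot; apply: eq_bigr => j _; rewrite !mxE.
Qed.

Lemma flat_delta (i : 'I_n) : (i < d)%N -> flat (delta_mx i 0 : E).
Proof.
move=> id j dj; rewrite mxE; case: eqP => // ji; move: dj; rewrite ji leqNgt.
by rewrite id.
Qed.

Lemma prox_residual : \forall w \near wb, [/\ U (P w), V (P w), M (P w) &
  forall i : 'I_n, (i < d)%N -> residual i (P w) = dot (w - wb) (chart_tangent i (P w))].
Proof.
have [dl dl0 H] := prox_identification.
apply/nbhs_enormP; exists dl => // w /H [Uw Vw Mw foc]; split => // i id.
have := foc _ (flat_delta id); rewrite -/(chart_tangent i (P w)) /residual.
move: (P w) (chart_tangent _ _) => x t h.
rewrite -[RHS]add0r -h -dotDl; congr dot.
by rewrite -addrA; congr (_ + _); rewrite addrA subrK.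
Qed.

Lemma residual0 (i : 'I_n) : (i < d)%N -> residual i xb = 0.
Proof.
move=> id; have [_ _ _ /(_ i id)] := nbhs_singleton prox_residual.
by rewrite Pwb subrr dot0l.
Qed.

(* Otherwise gamma g + |. - wb|^2 / 2 would grow less than quadratically along
   the curve of M with velocity v. *)
Lemma residual_injective (l : 'I_n -> E) v :
  (forall i, sdiff (residual i) xb (l i)) -> flat ('d psi xb v) ->
  (forall i : 'I_n, (i < d)%N -> dot (l i) v = 0) -> v = 0.
Proof.
move=> sl; set b := 'd psi xb v => fb lv.
have phib : 'd phi yb b = v by rewrite /b (diff_chartK v Uxb).
apply/eqP; apply: contrapT => /negP; rewrite -enorm_gt0 => a0.
set a := enorm v in a0.
(* At phi (yb + t b), S is the derivative along b of the objective read in the chart, see [dfE]. *)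
pose S x := \sum_i b i 0 * residual i x.
pose lS := \sum_i b i 0 *: l i.
have sS : sdiff S xb lS by apply: sdiff_sum => i; exact: sdiffZ.
have S0 : S xb = 0.
  apply: big1 => i _; have [id|id] := ltnP i d; first by rewrite residual0 // mulr0.
  by rewrite fb // mul0r.
have lSv : dot lS v = 0.
  rewrite dot_suml big1 // => i _; rewrite dotZl.
  have [id|id] := ltnP i d; first by rewrite lv // mulr0.
  by rewrite fb // mul0r.
have [r r0 Hr] : exists2 r, 0 < r & forall y, enorm (y - yb) < r -> W y /\ V (phi y).
  apply/nbhs_enormP; apply: filterI; first exact: open_nbhs_nbhs.
  apply: (differentiable_continuous (dphi Wyb)); rewrite phiyb.
  exact: open_nbhs_nbhs.
have b1 : 0 < enorm b + 1 by rewrite ltr_wpDl ?enorm_ge0.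
have s1 : 0 < enorm lS + 1 by rewrite ltr_wpDl ?enorm_ge0.
(* Growth forces an increase of at least s'^2 a^2 / 8, and e is half of that ratio. The constants
   come from [exists] to remain opaque to the arithmetic tactics. *)
have [e eE] : exists e, e = a ^+ 2 / 16 by exists (a ^+ 2 / 16).
have e0 : 0 < e by rewrite eE divr_gt0 // exprn_gt0.
(* The first bound keeps the curve within t a / 2 of xb + t v; the second makes this deviation
   contribute at most e t / 2 to the linear part <lS, .>. *)
have [e1 e1E] : exists e1, e1 =
    Num.min (a / 2 / (enorm b + 1)) (e / 2 / (enorm lS + 1) / (enorm b + 1)).
  by eexists.
have e10 : 0 < e1 by rewrite e1E lt_min !divr_gt0.
have [r1 r10 Hphi] := vec_expansion (dphi Wyb) e10.
have e20 : 0 < e / (4 * a) by rewrite divr_gt0 // mulr_gt0.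
have /nbhs2_enormP [r2 r20 HS] := sS _ e20.
have [m mE] : exists m, m =
    Num.min (Num.min (r / (enorm b + 1)) (r1 / (enorm b + 1))) (r2 / (2 * a)).
  by eexists.
have m0 : 0 < m by rewrite mE !lt_min !divr_gt0 // mulr_gt0.
have [s' [s'0 s'm]] : exists s', 0 < s' /\ s' < m by exists (m / 2); split; lra.
have curve t : 0 <= t -> t <= s' -> [/\ W (yb + t *: b), V (phi (yb + t *: b)),
    enorm (phi (yb + t *: b) - xb - t *: v) <= e1 * (t * enorm b) &
    t * (2 * a) < r2].
  move=> t0 ts.
  have := le_lt_trans ts s'm; rewrite mE.
  rewrite !lt_min -andbA => /and3P[t1 t2 t3].
  rewrite !ltr_pdivlMr ?mulr_gt0 // in t1 t2 t3.
  have tb : enorm (t *: b) = t * enorm b by rewrite enormZ ger0_norm.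
  have tb1 : t * enorm b <= t * (enorm b + 1) by rewrite ler_wpM2l // lerDl.
  have [|Wt Vt] := Hr (yb + t *: b).
    by rewrite addrAC subrr add0r tb; exact: le_lt_trans t1.
  split => //.
  have := Hphi (t *: b); rewrite tb => /(_ (le_lt_trans tb1 t2)).
  by rewrite phiyb linearZ /= phib.
have e1b : e1 * enorm b <= a / 2.
  have : e1 <= a / 2 / (enorm b + 1) by rewrite e1E ge_min lexx.
  rewrite ler_pdivlMr // => h; apply: le_trans h.
  by rewrite ler_pM2l // lerDl.
have e1S : enorm lS * (e1 * enorm b) <= e / 2.
  have : e1 <= e / 2 / (enorm lS + 1) / (enorm b + 1) by rewrite e1E ge_min lexx orbT.
  rewrite ler_pdivlMr // ler_pdivlMr // => h; apply: le_trans h.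
  rewrite mulrC; apply: ler_pM => //.
  - by apply: mulr_ge0; [exact: ltW|exact: enorm_ge0].
  - exact: enorm_ge0.
  - by rewrite ler_pM2l // lerDl.
  - by rewrite lerDl.
(* One half of e t is the strict differentiability error over a distance at most 2 t a; the other is
   the linear part, where <lS, v> = 0 leaves only the deviation from t v. *)
have Sbound t : 0 <= t -> t <= s' -> `|S (phi (yb + t *: b))| <= e * t.
  move=> t0 ts; have [Wt Vt ct t2] := curve t t0 ts.
  set c := phi (yb + t *: b) in ct Vt *.
  have tv : enorm (t *: v) = t * a by rewrite enormZ ger0_norm.
  have cx : enorm (c - xb) <= t * (2 * a).
    have : enorm (c - xb) <= enorm (c - xb - t *: v) + enorm (t *: v).
      by apply: le_trans (enormD _ _); rewrite subrK.
    rewrite tv; move: ct; rewrite mulrCA => ct.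
    have h : t * (e1 * enorm b) <= t * (a / 2) by rewrite ler_wpM2l.
    have h2 : 0 <= t * a by rewrite mulr_ge0 // ltW.
    lra.
  have x0 : enorm (xb - xb) < r2 by rewrite subrr enorm0.
  have := HS _ _ (le_lt_trans cx t2) x0; rewrite /= S0 subr0 => h1.
  have h2 : `|dot lS (c - xb)| <= e / 2 * t.
    rewrite (dot_orthB (c - xb) (_ : dot lS (t *: v) = 0)); last by rewrite dotZr lSv mulr0.
    apply: le_trans (abs_dot_le _ _) _.
    apply: (@le_trans _ _ (enorm lS * (e1 * (t * enorm b)))).
      by rewrite ler_wpM2l ?enorm_ge0.
    have -> : enorm lS * (e1 * (t * enorm b)) = enorm lS * (e1 * enorm b) * t by ring.
    by rewrite ler_wpM2r.
  have h3 : e / (4 * a) * enorm (c - xb) <= e / 2 * t.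
    apply: (@le_trans _ _ (e / (4 * a) * (t * (2 * a)))).
      by rewrite ler_wpM2l // ltW.
    rewrite le_eqVlt; apply/orP; left; apply/eqP; field.
    by rewrite gt_eqF.
  have := ler_normD (S c - dot lS (c - xb)) (dot lS (c - xb)); rewrite subrK.
  move: h1 h2 h3; move: (`|_|) (`|_|) (`|_|) (_ * enorm _) => *; lra.
pose f := prox_objective wb \o phi.
have [|th /andP[th0 th1] fth] := @mean_value _ _ f yb (s' *: b).
  move=> t /andP[t0 t1].
  have ts0 : 0 <= t * s' by rewrite mulr_ge0 // ltW.
  have ts1 : t * s' <= s' by rewrite ler_piMl // ltW.
  have [Wt Vt _ _] := curve _ ts0 ts1.
  rewrite scalerA; exact: (diff_prox_objective_chart wb 0 Wt Vt).1.
have ths0 : 0 <= th * s' by rewrite mulr_ge0 // ltW.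
have ths1 : th * s' <= s' by rewrite ler_piMl // ltW.
have [Wt Vt _ _] := curve _ ths0 ths1.
have dfE : 'd f (yb + (th * s') *: b) b = S (phi (yb + (th * s') *: b)).
  have [_ ->] := diff_prox_objective_chart wb b Wt Vt.
  have expand y : 'd phi y b = \sum_i b i 0 *: 'd phi y (delta_mx i 0).
    rewrite {1}(cV_sum_delta b) linear_sum; apply: eq_bigr => i _.
    by rewrite linearZ.
  rewrite expand dotC dot_suml; apply: eq_bigr => i _.
  by rewrite dotZl dotC /residual /chart_tangent (phiK Wt).2.
have fs : f (yb + s' *: b) - f yb <= e * s' ^+ 2.
  rewrite fth scalerA linearZ /= dfE.
  apply: (@le_trans _ _ (s' * (e * (th * s')))).
    by rewrite ler_pM2l //; apply: le_trans (ler_norm _) _; exact: Sbound.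
  by rewrite expr2 mulrCA (ler_pM2l e0) ler_pM2l.
have [Ws Vs cs _] := curve s' (ltW s'0) (lexx _).
have growth : 2^-1 * enorm (phi (yb + s' *: b) - xb) ^+ 2 <= f (yb + s' *: b) - f yb.
  have fs0 : flat (yb + s' *: b) by move=> i di; rewrite !mxE fyb // fb // mulr0 addr0.
  have := subdiff_growth g0 pF nondeg.1 (phi (yb + s' *: b)).
  rewrite (Fg Vs (chart_point Ws fs0)) (Fg Vxb Mxb).
  rewrite -!EFinM -!EFinD lee_fin /f /= /prox_objective phiyb.
  by rewrite lerBrDl.
have lower : s' * (a / 2) <= enorm (phi (yb + s' *: b) - xb).
  have tv : enorm (s' *: v) = s' * a by rewrite enormZ gtr0_norm.
  have h := enorm_dist (phi (yb + s' *: b) - xb) (s' *: v).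
  have h2 : s' * (e1 * enorm b) <= s' * (a / 2) by rewrite ler_pM2l.
  rewrite mulrCA in cs; have := le_trans h (le_trans cs h2).
  rewrite tv ler_norml => /andP[+ _]; rewrite lerBrDl; congr (_ <= _).
  by rewrite -mulrBr; congr (_ * _); field.
have sq : (s' * (a / 2)) ^+ 2 <= enorm (phi (yb + s' *: b) - xb) ^+ 2.
  by rewrite ler_sqr // nnegrE ?enorm_ge0 // mulr_ge0 ?ltW // divr_gt0.
rewrite exprMn expr_div_n in sq; rewrite eE in fs.
by apply: (quadratic_growth_absurd sq growth fs); rewrite exprn_gt0.
Qed.

Lemma prox_strict_diff : exists D : 'M[K]_n, forall e, 0 < e ->
  \forall p \near (wb, wb),
    enorm (P p.1 - P p.2 - D *m (p.1 - p.2)) <= e * enorm (p.1 - p.2).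
Proof.
have [l sl] := choice residual_sdiff.
(* Rows of the square system: tangency conditions for i < d, slice equations for the others. The
   latter do not involve w, whence the 0 in [T]. *)
pose L (i : 'I_n) := if (i < d)%N then l i else grad (fun x => psi x i 0) xb.
pose T (i : 'I_n) := if (i < d)%N then chart_tangent i xb else 0.
have Pne w w' : enorm (P w - P w') <= enorm (w - w') := prox_nonexpansive pF cF lF g0 w w'.
(* Pairs near (wb, wb) have images near (xb, xb), so expansions at xb can be used along these
   images; nonexpansiveness turns their errors into errors in |w - w'|. *)
have cP : (fun p : E * E => (P p.1, P p.2)) @ (wb, wb) --> (xb, xb).
  have := @lip_near_vec_cvg _ _ P wb 1 ler01; rewrite Pwb; apply.
  by apply: filterE => p; rewrite mul1r.
have resid : \forall p \near (wb, wb), forall w, w = p.1 \/ w = p.2 ->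
  [/\ U (P w), V (P w), M (P w) &
  forall i : 'I_n, (i < d)%N -> residual i (P w) = dot (w - wb) (chart_tangent i (P w))].
  have /nbhs_enormP [r r0 H] := prox_residual.
  apply/nbhs2_enormP; exists r => // y y' yr yr' w /=.
  by case=> ->; exact: H.
have rowi i e : 0 < e -> \forall p \near (wb, wb),
    `|dot (L i) (P p.1 - P p.2) - dot (T i) (p.1 - p.2)| <= e * enorm (p.1 - p.2).
  move=> e0; rewrite /L /T; have [id|id] := ltnP i d; last first.
    have h1 : \forall p \near (wb, wb), `|psi (P p.1) i 0 - psi (P p.2) i 0 -
      dot (grad (fun x => psi x i 0) xb) (P p.1 - P p.2)| <= e * enorm (P p.1 - P p.2) :=
      cP _ (Ck1_sdiff_vec i oU Uxb Ck1_psi e0).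
    apply: filterS2 h1 resid => p h1 rp; rewrite dot0l subr0.
    have [U1 _ M1 _] := rp _ (or_introl erefl).
    have [U2 _ M2 _] := rp _ (or_intror erefl).
    move: h1; rewrite ((slice U1).1 M1 i id) ((slice U2).1 M2 i id) subrr sub0r normrN.
    by move=> /le_trans; apply; rewrite ler_pM2l.
  have e3 : 0 < e / 3 by rewrite divr_gt0.
  have h1 : \forall p \near (wb, wb), `|residual i (P p.1) - residual i (P p.2) -
      dot (l i) (P p.1 - P p.2)| <= e / 3 * enorm (P p.1 - P p.2) := cP _ (sl i _ e3).
  have ltau j : lip_near (fun x => chart_tangent i x j 0) xb.
    by have [m sm] := chart_tangent_sdiff i j; exact: sdiff_lip sm.
  have [C C0 lipt] := lip_near_vec ltau.
  have h2 : \forall p \near (wb, wb), enorm (chart_tangent i (P p.1) - chart_tangent i (P p.2)) <=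
    C * enorm (P p.1 - P p.2) := cP _ lipt.
  have /nbhs2_enormP [r r0 h2'] := h2.
  have C1 : 0 < C + 1 by rewrite ltr_wpDl.
  have h3 : \forall p \near (wb, wb), enorm (p.1 - wb) < Num.min r (e / 3 / (C + 1)) /\
      enorm (p.2 - wb) < Num.min r (e / 3 / (C + 1)).
    apply/nbhs2_enormP; exists (Num.min r (e / 3 / (C + 1))) => //.
    by rewrite lt_min r0 divr_gt0.
  apply: filterS (filterI h1 (filterI h2 (filterI h3 resid))).
  move=> [w w'] /= [{}h1 [{}h2 [[{}h3 h3'] rp]]].
  have [_ _ _ /(_ i id) r1] := rp w (or_introl erefl).
  have [_ _ _ /(_ i id) r2] := rp w' (or_intror erefl).
  rewrite r1 r2 in h1; move: h3 h3'; rewrite !lt_min => /andP[h3 h4] /andP[_ h4'].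
  have wb0 : enorm (wb - wb) < r by rewrite subrr enorm0.
  have := h2' w wb h3 wb0; rewrite /= Pwb => h5.
  have n1 := Pne w w'; have := Pne w wb; rewrite Pwb => n2.
  move: (P w) (P w') h1 h2 h5 n1 n2 => x x' h1 h2 h5 n1 n2.
  (* Besides the error of [residual], two remainders are left. The first has the small factor tau(x)
     - tau(xb); in the second w' - wb is small and tau is Lipschitz. Each of the three takes e /
     3. *)
  have -> : dot (l i) (x - x') - dot (chart_tangent i xb) (w - w') =
    - (dot (w - wb) (chart_tangent i x) - dot (w' - wb) (chart_tangent i x') - dot (l i) (x - x')) +
    dot (w - w') (chart_tangent i x - chart_tangent i xb) +
    dot (w' - wb) (chart_tangent i x - chart_tangent i x').
    move: (chart_tangent i x) (chart_tangent i x') (chart_tangent i xb) (dot (l i) _) => t1 t2 t3 m.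
    by rewrite !dotE (dotC t3 w) (dotC t3 w'); ring.
  have D0 := enorm_ge0 (w - w').
  have k1 : `|dot (w - w') (chart_tangent i x - chart_tangent i xb)| <= e / 3 * enorm (w - w').
    apply: le_trans (abs_dot_le _ _) _; rewrite mulrC; apply: ler_wpM2r => //.
    apply: le_trans h5 _; apply: (@le_trans _ _ ((C + 1) * enorm (w - wb))).
      by apply: ler_pM; rewrite ?enorm_ge0 // lerDl.
    by rewrite mulrC -ler_pdivlMr // ltW.
  have k2 : `|dot (w' - wb) (chart_tangent i x - chart_tangent i x')| <= e / 3 * enorm (w - w').
    apply: le_trans (abs_dot_le _ _) _.
    apply: (@le_trans _ _ (enorm (w' - wb) * ((C + 1) * enorm (w - w')))).
      rewrite ler_wpM2l ?enorm_ge0 //; apply: le_trans h2 _.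
      by apply: ler_pM; rewrite ?enorm_ge0 // lerDl.
    by rewrite mulrA ler_wpM2r // -ler_pdivlMr // ltW.
  have k3 : e / 3 * enorm (x - x') <= e / 3 * enorm (w - w') by rewrite ler_pM2l.
  apply: le_trans (ler_normD _ _) _; apply: le_trans (lerD (ler_normD _ _) k2) _.
  rewrite normrN; apply: le_trans (lerD (lerD (le_trans h1 k3) k1) (lexx _)) _.
  by rewrite le_eqVlt; apply/orP; left; apply/eqP; field.
have Lunit : rows L \in unitmx.
  apply: injective_unitmx => v Lv0.
  have Lv i : dot (L i) v = 0 by rewrite -rowsE Lv0 mxE.
  apply: (residual_injective sl).
    move=> i id; have := Lv i; rewrite /L ltnNge id /= -diff_gradE.
    by have [_ ->] := diff_coord i (dpsi Uxb).
  by move=> i id; have := Lv i; rewrite /L id.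
exists (invmx (rows L) *m rows T) => e e0.
have [C C0 HC] := mulmx_bounded (invmx (rows L)).
have C1 : 0 < (C + 1) * n.+1%:R by rewrite mulr_gt0 ?ltr0n // ltr_wpDl.
have all_rows : \forall p \near (wb, wb), forall i : 'I_n,
    `|dot (L i) (P p.1 - P p.2) - dot (T i) (p.1 - p.2)|
    <= e / ((C + 1) * n.+1%:R) * enorm (p.1 - p.2).
  by apply: (@filter_forall _ _ _ (nbhs (wb, wb)) _) => i; apply: rowi; exact: divr_gt0.
apply: filterS all_rows => p Hp.
have -> : P p.1 - P p.2 - invmx (rows L) *m rows T *m (p.1 - p.2) =
    invmx (rows L) *m (rows L *m (P p.1 - P p.2) - rows T *m (p.1 - p.2)).
  move: (P p.1 - P p.2) (p.1 - p.2) => a b.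
  by rewrite mulmxBr mulKmx // mulmxA.
apply: le_trans (HC _) _.
have Hs : enorm (rows L *m (P p.1 - P p.2) - rows T *m (p.1 - p.2)) <=
   n.+1%:R * (e / ((C + 1) * n.+1%:R) * enorm (p.1 - p.2)).
  apply: le_trans (enorm_le_sum _) _.
  apply: (@le_trans _ _ (\sum_(i < n) e / ((C + 1) * n.+1%:R) * enorm (p.1 - p.2))).
    apply: ler_sum => i _.
    have -> : (rows L *m (P p.1 - P p.2) - rows T *m (p.1 - p.2)) i 0 =
      (rows L *m (P p.1 - P p.2)) i 0 - (rows T *m (p.1 - p.2)) i 0 by rewrite !mxE.
    by rewrite !rowsE; exact: Hp.
  rewrite sumr_const card_ord -[leLHS]mulr_natl ler_wpM2r ?ler_nat //.
  by rewrite mulr_ge0 ?enorm_ge0 // ltW // divr_gt0.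
apply: (@le_trans _ _ ((C + 1) * (n.+1%:R * (e / ((C + 1) * n.+1%:R) * enorm (p.1 - p.2))))).
  by apply: ler_pM; rewrite ?enorm_ge0 // lerDl.
have Cn : C + 1 != 0 by rewrite gt_eqF // ltr_wpDl.
have Nn : n.+1%:R != 0 :> K by rewrite pnatr_eq0.
rewrite le_eqVlt; apply/orP; left; apply/eqP.
by move: (C + 1) (n.+1%:R) Cn Nn => c m cn mn; field; rewrite cn mn.
Qed.

End ProxOnManifold.

(** * Local linearisation *)

Lemma partly_smooth_prox_strict_diff (K : realType) n (F : 'cV[K]_n -> \bar K)
    (gamma : K) M xb wb :
  proper_fun F -> convex_fun F -> lower_semicontinuous F -> 0 < gamma ->
  partly_smooth F M xb -> ri (subdiff F xb) (gamma^-1 *: (wb - xb)) ->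
  exists D : 'M[K]_n, forall e, 0 < e -> \forall p \near (wb, wb),
    enorm (prox gamma F p.1 - prox gamma F p.2 - D *m (p.1 - p.2)) <=
    e * enorm (p.1 - p.2).
Proof.
move=> pF cF lF g0 [[Mxb [d [U [W [psi [phi [_ Uxb diffeo slice]]]]]]]].
move=> [V [g [oV Vxb C2g Fg]]] sharp cont nondeg.
exact: (prox_strict_diff g0 pF Mxb Uxb diffeo slice oV Vxb C2g Fg sharp cont nondeg cF lF).
Qed.

Section DouglasRachfordLinearization.
Context {K : realType} {n : nat}.
Local Notation E := 'cV[K]_n.
Context (R J : E -> \bar K) (gamma : K) (zs : E) (DR DJ : 'M[K]_n).
Hypotheses (pJ : proper_fun J) (cJ : convex_fun J) (lJ : lower_semicontinuous J).
Hypothesis g0 : 0 < gamma.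
Local Notation PJ := (prox gamma J).
Local Notation PR := (prox gamma R).
Local Notation vs := (2 *: PJ zs - zs).
Hypothesis sdJ : forall e, 0 < e -> \forall p \near (zs, zs),
  enorm (PJ p.1 - PJ p.2 - DJ *m (p.1 - p.2)) <= e * enorm (p.1 - p.2).
Hypothesis sdR : forall e, 0 < e -> \forall p \near (vs, vs),
  enorm (PR p.1 - PR p.2 - DR *m (p.1 - p.2)) <= e * enorm (p.1 - p.2).

Lemma reflector_lip z w :
  enorm (2 *: PJ z - z - (2 *: PJ w - w)) <= 3 * enorm (z - w).
Proof.
have := prox_nonexpansive pJ cJ lJ g0 z w; move: (PJ z) (PJ w) => x y h.
rewrite (_ : _ - _ = 2 *: (x - y) - (z - w)); last first.
  by apply/matrixP => i j; rewrite !mxE; ring.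
apply: le_trans (enormB _ _) _; rewrite enormZ ger0_norm //.
by move: (enorm _) (enorm _) h => *; lra.
Qed.

(** The matrix is the formal derivative of z + PR (2 PJ z - z) - PJ z. Its error is that of PR plus
    (2 DR - I) applied to that of PJ. *)
Lemma dr_linearization_identity (z w x y u v : E) :
  z + u - x - (w + v - y) - (1%:M + DR *m (2 *: DJ - 1%:M) - DJ) *m (z - w) =
  (u - v - DR *m (2 *: x - z - (2 *: y - w))) +
  2 *: (DR *m (x - y - DJ *m (z - w))) - (x - y - DJ *m (z - w)).
Proof.
have -> : 2 *: x - z - (2 *: y - w) = 2 *: (x - y) - (z - w).
  by apply/matrixP => i j; rewrite !mxE; ring.
have -> : z + u - x - (w + v - y) = (z - w) + (u - v) - (x - y).
  by apply/matrixP => i j; rewrite !mxE; ring.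
move: (z - w) (u - v) (x - y) => a b c.
rewrite !mulmxBl mulmxDl mul1mx -mulmxA !mulmxBl mul1mx -scalemxAl !mulmxBr -!scalemxAr.
move: (DJ *m a) (DR *m a) (DR *m c) => p q r.
move: (DR *m p) => s.
by apply/matrixP => i j; rewrite !mxE; ring.
Qed.

Lemma F_DR_strict_diff : exists M : 'M[K]_n, forall e, 0 < e ->
  \forall p \near (zs, zs),
    enorm (F_DR gamma R J p.1 - F_DR gamma R J p.2 - M *m (p.1 - p.2)) <=
    e * enorm (p.1 - p.2).
Proof.
exists (1%:M + DR *m (2 *: DJ - 1%:M) - DJ) => e e0.
have [C C0 HC] := mulmx_bounded DR.
have C1 : 0 < 2 * C + 4 by lra.
(* In 2 C + 4, the reflector's Lipschitz bound contributes 3, the term 2 DR applied to the error of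
   PJ contributes 2 C, and that error itself 1. *)
pose e1 := e / (2 * C + 4).
have e10 : 0 < e1 by rewrite divr_gt0.
have cv : (fun p : E * E => (2 *: PJ p.1 - p.1, 2 *: PJ p.2 - p.2)) @ (zs, zs) --> (vs, vs).
  apply: (@lip_near_vec_cvg _ _ (fun z => 2 *: PJ z - z) zs 3) => //.
  by apply: filterE => p; exact: reflector_lip.
have hR : \forall p \near (zs, zs), enorm (PR (2 *: PJ p.1 - p.1) - PR (2 *: PJ p.2 - p.2)
    - DR *m (2 *: PJ p.1 - p.1 - (2 *: PJ p.2 - p.2))) <=
    e1 * enorm (2 *: PJ p.1 - p.1 - (2 *: PJ p.2 - p.2)) := cv _ (sdR e10).
apply: filterS2 hR (sdJ e10) => -[z w] /= h1 h2.
rewrite !F_DRE dr_linearization_identity.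
have h3 := reflector_lip z w.
have h4 := HC (PJ z - PJ w - DJ *m (z - w)).
apply: le_trans (enormB _ _) _; apply: le_trans (lerD (enormD _ _) h2) _.
rewrite enormZ ger0_norm //.
have h5 := le_trans h4 (ler_wpM2l C0 h2).
have h6 := le_trans h1 (ler_wpM2l (ltW e10) h3).
apply: le_trans (lerD (lerD h6 (ler_wpM2l (ler0n K 2) h5)) (lexx _)) _.
have -> : e = e1 * (2 * C + 4) by rewrite /e1 divfK // gt_eqF.
by rewrite le_eqVlt; apply/orP; left; apply/eqP; ring.
Qed.

End DouglasRachfordLinearization.

Theorem theorem3p9 (K : realType) (n : nat) (R J : 'cV[K]_n -> \bar K)
  (gamma : K) (u x z : nat -> 'cV[K]_n)
  (properR : proper_fun R) (convexR : convex_fun R)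
  (lscR : lower_semicontinuous R)
  (properJ : proper_fun J) (convexJ : convex_fun J)
  (lscJ : lower_semicontinuous J)
  (ri_dom : ri (edom R) `&` ri (edom J) !=set0)
  (argmin_RJ : argmin (fun y => R y + J y)%E !=set0)
  (gamma_gt0 : 0 < gamma)
  (x_init : x 0%N = prox gamma J (z 0%N))
  (u_step : forall k, u k.+1 = prox gamma R (2 *: x k - z k))
  (z_step : forall k, z k.+1 = z k + u k.+1 - x k)
  (x_step : forall k, x k.+1 = prox gamma J (z k.+1)) :
  exists zstar xstar : 'cV[K]_n,
    [/\ z @ \oo --> zstar,
        fixpoints (F_DR gamma R J) zstar,
        xstar = prox gamma J zstar,
        x @ \oo --> xstar /\ u @ \oo --> xstar &
        argmin (fun y => R y + J y)%E xstar] /\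
    forall MR MJ : set 'cV[K]_n,
      partly_smooth R MR xstar ->
      partly_smooth J MJ xstar ->
      (exists2 g, ri (subdiff R xstar) g & xstar - zstar = gamma *: g) ->
      (exists2 g, ri (subdiff J xstar) g & zstar - xstar = gamma *: g) ->
      exists M_DR : 'M[K]_n,
        forall k, z k.+1 - z k
          = M_DR *m (z k - z k.-1) +o_(k \near \oo) enorm (z k - z k.-1).
Proof.
have xE k : x k = prox gamma J (z k) by case: k => [|k]; [exact: x_init|exact: x_step].
have [zs [zcvg Tzs xcvg ucvg xmin]] := douglas_rachford_cvg properR convexR lscR
  properJ convexJ lscJ gamma_gt0 ri_dom argmin_RJ xE u_step z_step.
exists zs, (prox gamma J zs); split => //.
move=> MR MJ psR psJ [gR riR gRE] [gJ riJ gJE].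
have unscale g : gamma^-1 *: (gamma *: g) = g :> 'cV[K]_n.
  by rewrite scalerA mulVf ?gt_eqF // scale1r.
have [|DJ sdJ] := partly_smooth_prox_strict_diff (wb := zs) properJ convexJ lscJ gamma_gt0 psJ.
  by rewrite gJE unscale.
(* The prox of R acts at the reflected point 2 x* - z*; subtracting x* leaves x* - z*, the vector of
   the non-degeneracy condition on R. *)
have [|DR sdR] := partly_smooth_prox_strict_diff (wb := 2 *: prox gamma J zs - zs)
    properR convexR lscR gamma_gt0 psR.
  have -> : 2 *: prox gamma J zs - zs - prox gamma J zs = prox gamma J zs - zs.
    by move: (prox gamma J zs) => p; apply/matrixP => i j; rewrite !mxE; ring.
  by rewrite gRE unscale.
have [M sdM] := F_DR_strict_diff properJ convexJ lscJ gamma_gt0 sdJ sdR.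
exists M.
have zS k : z k.+1 = F_DR gamma R J (z k) by rewrite F_DRE z_step u_step xE.
suff E : (fun k => z k.+1 - z k) = (fun k => M *m (z k - z k.-1)) +o_\oo
    (fun k => enorm (z k - z k.-1)).
  by move=> k; exact: (congr1 (fun f => f k) E).
apply/eqaddoP => e e0.
have /nbhs2_enormP [d d0 Hd] := sdM e e0.
have [N HN] := (cvgn_enormP _ _).1 zcvg d d0.
(* Starting at [N.+1] makes [k.-1] a true predecessor and puts both iterates in the ball given by
   [sdM]. *)
exists N.+1 => // -[//|k] /= Nk; rewrite !fctE /=.
apply: le_trans (norm_le_enorm _) _; rewrite ger0_norm ?enorm_ge0 //.
by rewrite zS {2}zS; apply: Hd; apply: HN => //; exact: ltnW.
Qed.
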